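(* Let $m\ge2$ and let $\mathcal{H}\in\mathcal{P}(\mathcal{H})$ be a connected bicyclic linear $m$-uniform hypergraph with $k\ge8$ edges such that $\mathcal{H}\ne B_2C(k-6,0)$. Suppose $(k-12)(m-1)\ge56$. Then $\lambda_1(\mathcal{H})\le\lambda_1(B_2C(k-7,1))$, and equality holds only when $\mathcal{H}=B_2C(k-7,1)$.
   Context: A hypergraph has a finite vertex set and an edge set of non-empty subsets of the vertex set; it is $m$-uniform if all edges have cardinality $m$, and linear if two distinct edges share at most one vertex. The adjacency matrix of a linear $m$-uniform hypergraph has $(i,j)$ entry $\frac{1}{m-1}$ if $i\ne j$ lie in a common edge, and $0$ otherwise; $\lambda_1$ denotes the spectral radius of this matrix. The degree of a vertex is the number of edges containing it. The $m$-th power hypergraph of a graph $G(V,E)$ is the $m$-uniform hypergraph obtained by adding to each edge $e\in E$ $m-2$ new vertices $v_{e,1},\dots,v_{e,m-2}$ (distinct for distinct edges). $\mathcal{P}(\mathcal{H})$ denotes the set of $m$-th power hypergraphs of graphs (a fixed notation for the set, not depending on the particular hypergraph $\mathcal{H}$). A loose cycle of length $l\ge3$, $v_1e_1v_2e_2\dots v_le_lv_1$, is the $m$-uniform hypergraph with edges $e_1,\dots,e_l$ in which $e_{i-1}\cap e_i=\{v_i\}$ (indices mod $l$, the $v_i$ distinct) and non-consecutive edges are disjoint; $v_1,\dots,v_l$ are its core vertices. A linear hypergraph is bicyclic if it contains exactly two loose cycles. Attaching a pendant edge at a vertex $v$ means adding a new edge consisting of $v$ and $m-1$ new vertices. $BC(l_1)$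 is the linear hypergraph obtained by joining two loose cycles of length $3$ by identifying one core vertex of each, and attaching $l_1$ pendant edges at the identified vertex. $B_2C(l_1,l_2)$ is obtained from $BC(l_1)$ by attaching $l_2$ pendant edges at one vertex of degree $2$ of $BC(l_1)$ (i.e. at one of the four non-identified core vertices of the two cycles). Equality of hypergraphs means isomorphism. *)

(* Defs.v *)
From mathcomp Require Import all_boot all_order all_algebra.
From mathcomp Require Import boolp reals complex.
From mathcomp Require classical_sets.

Set Implicit Arguments.
Unset Strict Implicit.
Unset Printing Implicit Defensive.

Import GRing.Theory Num.Theory.

Record hypergraph := Hypergraph {
  vertices :> finType;
  edges : {set {set vertices}};
  edges_neq0 : set0 \notin edges }.

Definition uniform (m : nat) (H : hypergraph) : Prop :=
  forall e : {set H}, e \in edges H -> #|e| = m.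

Definition linear_hg (H : hypergraph) : Prop :=
  forall e f : {set H}, e \in edges H -> f \in edges H -> e != f ->
    #|e :&: f| <= 1.

Definition adj (H : hypergraph) : rel H :=
  fun x y => (x != y) && [exists e in edges H, (x \in e) && (y \in e)].

Definition connected_hg (H : hypergraph) : Prop :=
  forall x y : H, connect (@adj H) x y.

Definition hg_iso (H1 H2 : hypergraph) : Prop :=
  exists2 f : H1 -> H2, bijective f &
    [set f @: e | e : {set H1} in edges H1] = edges H2.

(* The edges, with consecutive indices taken modulo l, are numbered so that
   v i is the common vertex of e (ord_pred i) and e i. *)
Definition is_loose_cycle (T : finType) (C : {set {set T}}) : Prop :=
  exists l : nat, exists e : 'I_l -> {set T}, exists v : 'I_l -> T,
    [/\ 3 <= l, injective v, C = [set e i | i : 'I_l],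
        forall i, e (ord_pred i) :&: e i = [set v i] &
        forall i j, j != i -> j != ordS i -> i != ordS j ->
          e i :&: e j = set0].

(* A loose cycle contained in H is identified with its set of edges. *)
Definition bicyclic (H : hypergraph) : Prop :=
  #|[set C : {set {set H}} | (C \subset edges H) && `[< is_loose_cycle C >]]|
    = 2.

Section Power.
Variables (m : nat) (G : hypergraph).

Definition power_vertex : finType :=
  (G + {e : {set G} | e \in edges G} * 'I_(m - 2))%type.

Definition power_edge (e : {e : {set G} | e \in edges G}) :
    {set power_vertex} :=
  [set inl x | x in val e] :|: [set inr (e, j) | j : 'I_(m - 2)].

Lemma power_edges_neq0 :
  set0 \notin [set power_edge e | e : {e : {set G} | e \in edges G}].
Proof.
apply/imsetP=> -[[e eG] _ /setP E].
have /set0Pn[x xe] : e != set0.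
  by apply: contraNneq (edges_neq0 G) => <-.
by move: (E (inl x)); rewrite !inE imset_f.
Qed.

Definition power : hypergraph := Hypergraph power_edges_neq0.

End Power.

(* A simple graph is a 2-uniform hypergraph. *)
Definition in_P (m : nat) (H : hypergraph) : Prop :=
  exists2 G : hypergraph, uniform 2 G & hg_iso H (power m G).

(* inl i is the i-th core vertex and the inr (i, j) are the m - 2 vertices
   which lie on the i-th edge only. *)
Section LooseCycle.
Variables m l : nat.

Definition loose_cycle_vertex : finType := ('I_l + 'I_l * 'I_(m - 2))%type.

Definition loose_cycle_edge (i : 'I_l) : {set loose_cycle_vertex} :=
  [set inl i; inl (ordS i)] :|: [set inr (i, j) | j : 'I_(m - 2)].

Lemma loose_cycle_edges_neq0 :
  set0 \notin [set loose_cycle_edge i | i : 'I_l].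
Proof.
by apply/imsetP=> -[i _ /setP/(_ (inl i))]; rewrite !inE eqxx.
Qed.

Definition loose_cycle : hypergraph := Hypergraph loose_cycle_edges_neq0.

End LooseCycle.

(* H1 and H2 joined by identifying u1 with u2: the identified vertex is
   represented by inl u1. *)
Section Coalescence.
Variables (H1 H2 : hypergraph) (u1 : H1) (u2 : H2).

Definition coalesce_vertex : finType := (H1 + {y : H2 | y != u2})%type.

Definition coalesce_in2 (y : H2) : coalesce_vertex :=
  if insub y is Some y' then inr y' else inl u1.

Definition coalesce_edges : {set {set coalesce_vertex}} :=
  [set [set inl x | x in e] | e : {set H1} in edges H1] :|:
  [set coalesce_in2 @: e | e : {set H2} in edges H2].

Lemma coalesce_edges_neq0 : set0 \notin coalesce_edges.
Proof.
rewrite inE negb_or; apply/andP; split; apply/imsetP=> -[e eH /esym/eqP].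
- by rewrite imset_eq0 => /eqP e0; move: (edges_neq0 H1); rewrite -e0 eH.
- by rewrite imset_eq0 => /eqP e0; move: (edges_neq0 H2); rewrite -e0 eH.
Qed.

Definition coalesce : hypergraph := Hypergraph coalesce_edges_neq0.

End Coalescence.

(* H with n pendant edges of cardinality m attached at v; the vertices of H
   are embedded by inl. *)
Section Pendant.
Variables (m n : nat) (H : hypergraph) (v : H).

Definition pendant_vertex : finType := (H + 'I_n * 'I_(m - 1))%type.

Definition pendant_edge (i : 'I_n) : {set pendant_vertex} :=
  inl v |: [set inr (i, j) | j : 'I_(m - 1)].

Definition pendant_edges : {set {set pendant_vertex}} :=
  [set [set inl x | x in e] | e : {set H} in edges H] :|:
  [set pendant_edge i | i : 'I_n].

Lemma pendant_edges_neq0 : set0 \notin pendant_edges.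
Proof.
rewrite inE negb_or; apply/andP; split; apply/imsetP.
- move=> -[e eH /esym/eqP].
  by rewrite imset_eq0 => /eqP e0; move: (edges_neq0 H); rewrite -e0 eH.
- by move=> -[i _ /setP/(_ (inl v))]; rewrite !inE eqxx.
Qed.

Definition attach_pendants : hypergraph := Hypergraph pendant_edges_neq0.

End Pendant.

Definition core (m : nat) (i : 'I_3) : loose_cycle m 3 := inl i.

Definition two_triangles (m : nat) : hypergraph :=
  coalesce (core m ord0) (core m ord0).

Definition BC (m l1 : nat) : hypergraph :=
  @attach_pendants m l1 (two_triangles m) (inl (core m ord0)).

(* The four vertices of BC m l1 at which l2 pendant edges may be attached are
   equivalent under automorphisms; core vertex 2 of the first cycle is used. *)
Definition B2C (m l1 l2 : nat) : hypergraph :=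
  @attach_pendants m l2 (BC m l1) (inl (inl (core m ord_max))).

Section Spectrum.
Local Open Scope ring_scope.
Local Open Scope complex_scope.

Definition adjacency (R : realType) (m : nat) (H : hypergraph) : 'M[R]_#|H| :=
  \matrix_(i, j) if adj (enum_val i) (enum_val j) then (m%:R - 1)^-1 else 0.

(* Largest modulus of a complex eigenvalue. *)
Definition spectral_radius (R : realType) (n : nat) (A : 'M[R]_n) : R :=
  sup (classical_sets.mkset (fun r : R => exists2 z : R[i],
    eigenvalue (map_mx (fun x : R => x%:C) A) z & `|z| = r%:C)).

Definition lambda1 (R : realType) (m : nat) (H : hypergraph) : R :=
  spectral_radius (adjacency R m H).

End Spectrum.

(* Main.v *)
Require Import Defs.
From mathcomp Require Import all_boot all_order all_algebra.
From mathcomp Require Import reals.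
From mathcomp Require Import boolp complex.
From mathcomp Require classical_sets.
From mathcomp Require Import zify ring lra.

(* Let H be the m-th power of G, lambda = mu / (m - 1) and q = m - 2.
   The numerator mu of an eigenvalue is compared with the quadratic form
   w |-> sum_(edges h) ((sum_h w)^2 - sum_h w^2) of H.  Maximising over the
   values at the added vertices turns mu = t + q into the bound t + beta for the
   form sum_(uv in E(G)) (2 x_u x_v + beta (x_u^2 + x_v^2)) on G, where
   beta = q / (t + q + 1).

   Let x >= 0 on G be largest at c.  The two cycles of G share at most one
   vertex, so one edge can be removed from each, these two edges being disjoint
   and avoiding c, and the rest is a spanning tree.  Reattaching to c all
   tree edges but one, and sometimes moving one end of another edge towards a
   larger value of x, increases the form and yields the graph of B2C (k - 7) 1,
   unless G is already a star at c with two more edges, that is, the graph of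
   B2C (k - 6) 0.  The form of B2C (k - 7) 1 is bounded by means of its Perron
   vector, which exists by the intermediate value theorem and has its strict
   maximum at c; hence equality is possible only if no edge was moved. *)

Set Implicit Arguments.
Unset Strict Implicit.
Unset Printing Implicit Defensive.

Import Order.TTheory GRing.Theory Num.Theory.

(** The vector x stems from the moduli of the entries of an arbitrary eigenvector of H. It is
    nonnegative, but it may vanish at vertices and need not be a maximiser, so moving an edge need
    not increase the form strictly. Strictness is recovered backwards: the form of the extremal
    graph falls short of its bound by an explicit sum of squares, so reaching the bound makes x
    proportional to the eigenvector written down for that graph, whose entries are positive and
    suitably ordered. The spectral radius is a supremum over finitely many eigenvalues, so a strict
    bound at each of them is enough.

    The condition (k - 12)(m - 1) >= 56 places t at 4 or above: with N = k - 7 and M = m - 1 it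
    reads 56 + 5 M <= N M. From t >= 4 and beta < 1 follow the inequalities among the entries: all
    but the one at c are below 1, and the one at a exceeds those at the pendant vertices. *)

Ltac distinct :=
  rewrite /= ?inE ?negb_or;
  repeat match goal with
  | |- is_true (_ && _) -> _ => case/andP
  | |- is_true _ -> _ => let H := fresh "H" in intro H
  end;
  repeat (apply/andP; split);
  first [assumption | rewrite eq_sym; assumption | done].

(** * Cycles and spanning trees *)

Section Cycles.
Variable T : finType.
Implicit Types (C D E : {set {set T}}) (e : {set T}) (x y u v : T).

(** The edge set is a parameter, so that deleting edges leaves the vertex type unchanged. *)
Definition gadj E : rel T := fun x y => (x != y) && ([set x; y] \in E).

Lemma gadj_sym E : symmetric (gadj E).
Proof. by move=> x y; rewrite /gadj eq_sym setUC. Qed.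

Lemma gconnect_sym E : connect_sym (gadj E).
Proof. exact/sym_connect_sym/gadj_sym. Qed.

Lemma gconnect_sub D E x y :
  D \subset E -> connect (gadj D) x y -> connect (gadj E) x y.
Proof.
move=> sDE; apply: connect_sub => u v /andP[nuv uv].
by apply: connect1; rewrite /gadj nuv (subsetP sDE).
Qed.

Lemma gconnect_cut (X : {set T}) E x y :
  connect (gadj E) x y ->
  (forall u v, [set u; v] \in E -> (u \in X) = (v \in X)) ->
  (x \in X) = (y \in X).
Proof.
move=> /connectP[p]; elim: p x => [|z p IH] x /=; first by move=> _ ->.
move=> /andP[/andP[_ xz] pz] yE sX.
by rewrite (sX _ _ xz); apply: IH.
Qed.

Lemma card2P e : #|e| = 2 -> exists u v, u != v /\ e = [set u; v].
Proof. by move=> /eqP /cards2P[u [v [nuv ->]]]; exists u, v. Qed.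

Lemma set2_inj x y z : [set x; y] = [set x; z] -> y = z.
Proof.
move=> /setP E; have := E y; rewrite !inE eqxx orbT => /esym/orP[/eqP yx|/eqP //].
by have := E z; rewrite !inE eqxx orbT yx orbb => /eqP.
Qed.

Lemma set2_eq x y u v : [set x; y] = [set u; v] ->
  (x = u /\ y = v) \/ (x = v /\ y = u).
Proof.
move=> E; have : x \in [set u; v] by rewrite -E set21.
rewrite !inE => /orP[]/eqP xE; [left|right]; split => //.
  by apply: (@set2_inj x); rewrite E xE.
by apply: (@set2_inj x); rewrite E xE setUC.
Qed.

(* The vertices of a cycle, listed from a chosen one until the walk closes. *)
Definition cycle_walk C (l : nat) (f : nat -> T) :=
  [/\ 2 < l, f l = f 0,
      forall i j, i < l -> j < l -> f i = f j -> i = j &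
      forall e, e \in C <-> exists2 i, i < l & e = [set f i; f i.+1]].

Lemma val_iter_ordS l (i : 'I_l) n : val (iter n (@ordS l) i) = (i + n) %% l.
Proof.
elim: n => [|n IH] /=; first by rewrite addn0 modn_small.
by rewrite IH -addn1 modnDml addn1 addnS.
Qed.

(** Since [e i] has two elements and contains the distinct vertices [v i] and [v (ordS i)], it is
    this pair; shifting the indices brings x to position 0. *)
Lemma loose_cycle_walk C x :
  (forall e, e \in C -> #|e| = 2) -> is_loose_cycle C -> x \in cover C ->
  exists l f, cycle_walk C l f /\ f 0 = x.
Proof.
move=> C2 [l [e [v [l3 v_inj CE capE _]]]] /bigcupP[g gC xg].
have vS (i : 'I_l) : ordS i != i.
  apply/eqP => /(congr1 val) /=.
  have := ltn_ord i; rewrite leq_eqVlt => /orP[/eqP li|li].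
    by rewrite li modnn; lia.
  by rewrite modn_small //; lia.
have eE i : e i = [set v i; v (ordS i)].
  apply/esym/eqP; rewrite eqEcard C2; last by rewrite CE imset_f.
  rewrite cards2 (inj_eq v_inj) eq_sym vS andbT.
  apply/subsetP => y; rewrite !inE => /orP[]/eqP->.
    by have /setP/(_ (v i)) := capE i; rewrite !inE eqxx => /andP[].
  by have /setP/(_ (v (ordS i))) := capE (ordS i);
     rewrite ordSK !inE eqxx => /andP[].
have [i0 xv] : exists i, x = v i.
  move: gC; rewrite CE => /imsetP[i _ gE]; move: xg; rewrite gE eE !inE.
  by case/orP => /eqP->; [exists i | exists (ordS i)].
pose h n := iter n (@ordS l) i0.
exists l, (fun n => v (h n)); split; last by rewrite xv.
have l0 : 0 < l by lia.
split => //.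
- by congr v; apply: val_inj; rewrite !val_iter_ordS addn0 modnDr.
- move=> i j li lj /v_inj /(congr1 val); rewrite !val_iter_ordS => /eqP.
  by rewrite eqn_modDl !modn_small // => /eqP.
- move=> g'; rewrite CE; split.
    move=> /imsetP[j _ ->].
    (* The number of steps from i0 forward to j, modulo l. *)
    exists ((j + (l - i0)) %% l); first by rewrite ltn_mod.
    have hj : h ((j + (l - i0)) %% l) = j.
      apply: val_inj; rewrite val_iter_ordS modnDmr addnCA subnKC; last first.
        by rewrite ltnW.
      by rewrite modnDr modn_small.
    by rewrite -[in LHS]hj eE.
  by move=> [i _ ->]; apply/imsetP; exists (h i) => //; rewrite eE.
Qed.

Lemma walk_connect D (f : nat -> T) a b : a <= b ->
  (forall j, a <= j < b -> [set f j; f j.+1] \in D) ->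
  connect (gadj D) (f a) (f b).
Proof.
elim: b => [|b IH]; first by rewrite leqn0 => /eqP->.
rewrite leq_eqVlt => /orP[/eqP->//|ab] fD.
apply: (connect_trans (IH ab _)) => [j /andP[aj jb]|].
  by apply: fD; rewrite aj ltnS ltnW.
case: (eqVneq (f b) (f b.+1)) => [->//|nf].
by apply: connect1; rewrite /gadj nf fD // ltnS leqnn andbT -ltnS.
Qed.

(** The pairs could also agree crosswise; then i and j would each be the successor of the other
    modulo l, which is impossible for l >= 3. *)
Lemma walk_edge_inj C l f i j : cycle_walk C l f -> i < l -> j < l ->
  [set f i; f i.+1] = [set f j; f j.+1] -> i = j.
Proof.
move=> [l3 fl f_inj _] li lj /set2_eq[[fi _]|[fi fi1]]; first exact: f_inj.
have fS n : n < l -> f n.+1 = f (n.+1 %% l).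
  rewrite leq_eqVlt => /orP[/eqP nl|nl]; last by rewrite modn_small.
  by rewrite nl modnn fl.
have l0 : 0 < l by lia.
move: fi fi1; rewrite !fS // => /f_inj fi /f_inj fj.
have {}fi : i = j.+1 %% l by apply: fi => //; rewrite ltn_mod.
have {}fj : i.+1 %% l = j by apply: fj => //; rewrite ltn_mod.
move: li lj; rewrite leq_eqVlt => /orP[/eqP il|il];
  rewrite leq_eqVlt => /orP[/eqP jl|jl].
- by lia.
- by move: fj fi; rewrite il modnn modn_small // => <-; lia.
- by move: fi fj; rewrite jl modnn modn_small // => ->; lia.
- by move: fi fj; rewrite !modn_small //; lia.
Qed.

Section OneCycle.
Variable C : {set {set T}}.
Hypothesis C2 : forall e, e \in C -> #|e| = 2.
Hypothesis cycC : is_loose_cycle C.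

Lemma loose_cycle_neq0 : exists e, e \in C.
Proof.
case: cycC => l [e [v [l3 _ -> _ _]]].
have i : 'I_l by apply: (@Ordinal l 0); lia.
by exists (e i); rewrite imset_f.
Qed.

(** The rest of the cycle joins the ends of the edge the other way round, passing through position
    l, which is position 0. *)
Lemma cycle_edge_connect x y :
  [set x; y] \in C -> connect (gadj (C :\ [set x; y])) x y.
Proof.
move=> xyC.
have xC : x \in cover C by apply/bigcupP; exists [set x; y]; rewrite ?set21.
have [l [f [W _]]] := loose_cycle_walk C2 cycC xC.
have [l3 fl f_inj CE] := W.
have [n nl xyE] := proj1 (CE _) xyC.
set D := C :\ _.
have DE j : j < l -> j != n -> [set f j; f j.+1] \in D.
  move=> jl jn; rewrite in_setD1 (_ : _ \in C) ?andbT; last by apply/CE; exists j.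
  by apply: contraNneq jn; rewrite xyE => /(walk_edge_inj W)->.
have con : connect (gadj D) (f n.+1) (f n).
  apply: (@connect_trans _ _ (f l)).
    by apply: walk_connect => // j /andP[nj jl]; apply: DE => //; lia.
  rewrite fl; apply: walk_connect => // j /andP[nj jl].
  by apply: DE; lia.
have := set2_eq xyE => -[[-> ->]|[-> ->]] //.
by rewrite gconnect_sym.
Qed.

(* Here g is the other edge of the cycle at u. *)
Lemma cycle_vertex_connect u : u \in cover C ->
  exists y g, [/\ u != y, [set u; y] \in C, g \in C, g != [set u; y] &
    forall v, v \in cover C -> v != u ->
      connect (gadj (C :\ [set u; y] :\ g)) y v].
Proof.
move=> uC; have [l [f [W f0]]] := loose_cycle_walk C2 cycC uC.
have [l3 fl f_inj CE] := W.
have inC j : j < l -> [set f j; f j.+1] \in C by move=> jl; apply/CE; exists j.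
exists (f 1), [set f l.-1; f l.-1.+1]; rewrite -f0; split.
- apply/eqP => /f_inj H; have : 0 = 1 by apply: H; lia.
  by [].
- by apply: inC; lia.
- by apply: inC; lia.
- apply/eqP => /(walk_edge_inj W) H; have : l.-1 = 0 by apply: H; lia.
  by lia.
move=> v /bigcupP[e eC ve] nv.
have [j /andP[j0 jl] ->] : exists2 j, 0 < j < l & v = f j.
  have [i il eE] := proj1 (CE _) eC.
  have [j jl vE] : exists2 j, j < l & v = f j.
    move: ve; rewrite eE !inE => /orP[]/eqP->; first by exists i.
    move: il; rewrite leq_eqVlt => /orP[/eqP->|il]; last by exists i.+1.
    by exists 0; rewrite ?fl //; lia.
  exists j => //; rewrite jl andbT lt0n; apply: contraNneq nv => j0.
  by rewrite vE j0.
apply: walk_connect => // i /andP[i1 ij].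
rewrite !in_setD1 inC ?andbT; last by lia.
apply/andP; split; apply/eqP => /(walk_edge_inj W) H.
  have : i = l.-1 by apply: H; lia.
  by lia.
have : i = 0 by apply: H; lia.
by lia.
Qed.

(** Listed from s, the cycle has further vertices at positions 1 and 2, and the edge between them
    misses s. *)
Lemma cycle_edge_avoid s : exists2 e, e \in C & s \notin e.
Proof.
have [sC|sC] := boolP (s \in cover C); last first.
  have [e eC] := loose_cycle_neq0; exists e => //.
  by apply: contra sC => se; apply/bigcupP; exists e.
have [l [f [W f0]]] := loose_cycle_walk C2 cycC sC.
have [l3 fl f_inj CE] := W.
exists [set f 1; f 2]; first by apply/CE; exists 1 => //; lia.
rewrite -f0 !inE; apply/norP; split; apply/eqP => /f_inj H.
  have : 0 = 1 by apply: H; lia.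
  by [].
have : 0 = 2 by apply: H; lia.
by [].
Qed.

End OneCycle.

Lemma loose_cycle_of_walk l (v : 'I_l -> T) : 2 < l -> injective v ->
  is_loose_cycle [set [set v i; v (ordS i)] | i : 'I_l].
Proof.
move=> l3 v_inj.
have vS (i : 'I_l) : ordS i != i.
  apply/eqP => /(congr1 val) /=.
  have := ltn_ord i; rewrite leq_eqVlt => /orP[/eqP li|li].
    by rewrite li modnn; lia.
  by rewrite modn_small //; lia.
(* For l >= 3 two consecutive edges cannot share both ends. *)
have vSS (i : 'I_l) : ordS (ordS i) != i.
  apply/eqP => /(congr1 val) /=.
  have := ltn_ord i; rewrite leq_eqVlt => /orP[/eqP li|li].
    by rewrite li modnn modn_small; lia.
  rewrite (modn_small li); move: li; rewrite leq_eqVlt => /orP[/eqP li|li].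
    by rewrite li modnn; lia.
  by rewrite modn_small //; lia.
exists l, (fun i => [set v i; v (ordS i)]), v; split => //.
- move=> i; rewrite ord_predK; apply/setP => y; rewrite !inE.
  case: (eqVneq y (v i)) => [->|ny]; first by rewrite orbT.
  rewrite orbF /=; apply/negP => /andP[/eqP-> ]; rewrite (inj_eq v_inj) => /eqP H.
  by move: (vSS (ord_pred i)); rewrite ord_predK -H eqxx.
- move=> i j nji njSi niSj; apply/setP => y; rewrite !inE.
  apply/negP => /andP[/orP[]/eqP-> ]; rewrite !(inj_eq v_inj) => /orP[]/eqP H.
  + by rewrite H eqxx in nji.
  + by rewrite H eqxx in niSj.
  + by rewrite H eqxx in njSi.
  + by rewrite (can_inj (@ordSK l) H) eqxx in nji.
Qed.

(** A simple path from x to y that does not use the edge x y has an inner vertex, so x y closes it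
    to a cycle of length at least three. *)
Lemma loose_cycle_through E x y : x != y -> [set x; y] \in E ->
  connect (gadj (E :\ [set x; y])) x y ->
  exists C, [/\ is_loose_cycle C, C \subset E & [set x; y] \in C].
Proof.
move=> nxy xyE /connectP[p0 p0p p0y].
case/shortenP: p0p p0y => p pp up _ ylast {p0}.
case: p => [|z [|z' p]] in pp up ylast *; first by rewrite ylast eqxx in nxy.
  by move: pp; rewrite ylast /= /gadj in_setD1 eqxx andbF.
set s := [:: x, z, z' & p] in up.
have szs : size s = (size p).+3 by [].
pose v (i : 'I_(size p).+3) := nth x s i.
have v_inj : injective v.
  by move=> i j /eqP; rewrite nth_uniq // => /eqP /val_inj.
exists [set [set v i; v (ordS i)] | i : 'I_(size p).+3]; split.
- exact: loose_cycle_of_walk.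
- apply/subsetP => _ /imsetP[i _ ->].
  have := ltn_ord i; rewrite leq_eqVlt => /orP[/eqP [li]|li].
    rewrite /v /= li modnn /= setUC.
    by move: ylast; rewrite /= (last_nth x) => <-.
  rewrite /v /= modn_small //.
  have /pathP := pp => /(_ x i) /=; rewrite ltnS in li => /(_ li).
  by rewrite /gadj in_setD1 => /and3P[].
- apply/imsetP; exists ord_max => //; rewrite /v /= modnn /= setUC.
  by move: ylast; rewrite /= (last_nth x) => <-.
Qed.

End Cycles.

(** * Connected graphs with exactly two cycles *)

Section TwoCycles.
Variables (T : finType) (E : {set {set T}}).
Implicit Types (C D : {set {set T}}) (x y u v c : T).
Hypothesis E2 : forall e, e \in E -> #|e| = 2.
Hypothesis Econ : forall x y, connect (gadj E) x y.

Definition two_cycles C1 C2 :=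
  [/\ C1 != C2, is_loose_cycle C1 /\ C1 \subset E,
      is_loose_cycle C2 /\ C2 \subset E &
      forall C, is_loose_cycle C -> C \subset E -> C = C1 \/ C = C2].

Lemma two_cycles_sym C1 C2 : two_cycles C1 C2 -> two_cycles C2 C1.
Proof.
move=> [nC c1 c2 cE]; split => //; first by rewrite eq_sym.
by move=> C cC CE; case: (cE C cC CE); [right|left].
Qed.

Lemma edge_neq x y : [set x; y] \in E -> x != y.
Proof. by move=> /E2; rewrite cards2; case: eqP. Qed.

Section Fixed.
Variables C1 C2 : {set {set T}}.
Hypothesis tc : two_cycles C1 C2.

(** Applied to sets D that omit an edge of each cycle that might contain x y, so that both
    alternatives are absurd. *)
Lemma two_cycles_through D x y : D \subset E -> [set x; y] \in D ->
  connect (gadj (D :\ [set x; y])) x y ->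
  (C1 \subset D /\ [set x; y] \in C1) \/ (C2 \subset D /\ [set x; y] \in C2).
Proof.
move=> DE xyD con; have xyE := subsetP DE _ xyD.
have [C [cC CD xyC]] := loose_cycle_through (edge_neq xyE) xyD con.
have [_ _ _ only] := tc.
by case: (only C cC (subset_trans CD DE)) => <-; [left|right].
Qed.

End Fixed.

Lemma cycle_card2 C : C \subset E -> forall e, e \in C -> #|e| = 2.
Proof. by move=> /subsetP sCE e /sCE /E2. Qed.

(* If two cycles shared the edge g, then an edge h of one but not the other would
   lie on a third cycle avoiding g. *)
Lemma cycles_edge_disjoint C1 C2 e :
  two_cycles C1 C2 -> e \in C1 -> e \in C2 -> False.
Proof.
have aux D1 D2 g h : two_cycles D1 D2 -> g \in D1 -> g \in D2 ->
    h \in D1 -> h \notin D2 -> False.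
  move=> tc gD1 gD2 hD1 hD2; have [_ [c1 s1] [c2 s2] _] := tc.
  have hE := subsetP s1 _ hD1.
  have [x [y [nxy hxy]]] := card2P (E2 hE); rewrite {}hxy in hE hD1 hD2.
  have gh : [set x; y] != g by apply: contraNneq hD2 => ->.
  have DE : E :\ g \subset E by apply: subsetDl.
  have xyD : [set x; y] \in E :\ g by rewrite in_setD1 gh.
  have con : connect (gadj (E :\ g :\ [set x; y])) x y.
    apply: connect_sub (cycle_edge_connect (cycle_card2 s1) c1 hD1) => u v.
    rewrite /gadj in_setD1 => /and3P[nuv nuvh uvD].
    (* A step along g is replaced by the rest of D2, which avoids the edge x y because that edge is
       not in D2. *)
    case: (eqVneq [set u; v] g) => [uvg|nuvg].
      rewrite -uvg in gD2.
      apply: gconnect_sub (cycle_edge_connect (cycle_card2 s2) c2 gD2).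
      apply/subsetP => k; rewrite !in_setD1 uvg => /andP[-> kD2].
      rewrite (subsetP s2) // !andbT.
      by apply: contraNneq hD2 => <-.
    by apply: connect1; rewrite !in_setD1 nuv nuvh nuvg (subsetP s1).
  case: (two_cycles_through tc DE xyD con) => -[/subsetP sub _].
    by have := sub _ gD1; rewrite in_setD1 eqxx.
  by have := sub _ gD2; rewrite in_setD1 eqxx.
move=> tc e1 e2; have [nC _ _ _] := tc.
have [s12|/subsetPn[h h1 h2]] := boolP (C1 \subset C2).
  have [s21|/subsetPn[h h2 h1]] := boolP (C2 \subset C1).
    by rewrite eqEsubset s12 s21 in nC.
  exact: (aux _ _ e h (two_cycles_sym tc)).
exact: (aux _ _ e h tc).
Qed.

(* With two common vertices u and v, the edge u y of C1 would lie on a cycle that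
   runs from y to v in C1 and back to u in C2. *)
Lemma cycles_vertex_disjoint C1 C2 u v : two_cycles C1 C2 ->
  u \in cover C1 -> u \in cover C2 -> v \in cover C1 -> v \in cover C2 -> u = v.
Proof.
move=> tc u1 u2 v1 v2; apply/eqP; apply/negPn/negP => nuv.
have [_ [c1 s1] [c2 s2] _] := tc; rewrite eq_sym in nuv.
have [y [g [uy uyC gC guy con1]]] :=
  cycle_vertex_connect (cycle_card2 s1) c1 u1.
have [y' [g' [uy' uyC' _ _ con2]]] :=
  cycle_vertex_connect (cycle_card2 s2) c2 u2.
have disj h : h \in C1 -> h \notin C2.
  by move=> h1; apply/negP => /(cycles_edge_disjoint tc h1).
have uv2 : connect (gadj C2) u v.
  apply: (@connect_trans _ _ y').
    by apply: connect1; rewrite /gadj uy'.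
  apply: gconnect_sub (con2 v v2 nuv).
  by apply/subsetP => h; rewrite !in_setD1 => /and3P[].
have con : connect (gadj (E :\ g :\ [set u; y])) u y.
  apply: (@connect_trans _ _ v).
    apply: gconnect_sub uv2; apply/subsetP => h h2.
    rewrite !in_setD1 (subsetP s2 _ h2) andbT.
    by apply/andP; split; apply: contraTneq h2 => ->; apply: disj.
  rewrite gconnect_sym; apply: gconnect_sub (con1 v v1 nuv).
  apply/subsetP => h; rewrite !in_setD1 => /and3P[-> -> hC].
  exact: (subsetP s1).
have uyE : [set u; y] \in E :\ g.
  by rewrite in_setD1 eq_sym guy (subsetP s1).
case: (two_cycles_through tc (subsetDl E [set g]) uyE con) => -[/subsetP sub uyC0].
  by have := sub _ gC; rewrite in_setD1 eqxx.
exact: (cycles_edge_disjoint tc uyC).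
Qed.

(** The cycles share at most one vertex. If c lies on both, it is that vertex, and edges avoiding c
    cannot meet. Otherwise, on a cycle that misses c, the edge can be chosen to avoid the shared
    vertex instead. *)
Lemma disjoint_cycle_edges C1 C2 c : two_cycles C1 C2 ->
  exists e1 e2, [/\ e1 \in C1, e2 \in C2, c \notin e1, c \notin e2 &
    [disjoint e1 & e2]].
Proof.
have aux D1 D2 : two_cycles D1 D2 -> c \notin cover D1 ->
    exists e1 e2, [/\ e1 \in D1, e2 \in D2, c \notin e1, c \notin e2 &
    [disjoint e1 & e2]].
  move=> tc cD1; have [_ [c1 s1] [c2 s2] _] := tc.
  have [e2 e2C ce2] := cycle_edge_avoid (cycle_card2 s2) c2 c.
  have avoid s : exists2 e, e \in D1 & s \notin e.
    exact: (cycle_edge_avoid (cycle_card2 s1) c1).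
  (* The shared vertex of the two cycles, with c as default when there is none. *)
  pose s := odflt c [pick x | (x \in cover D1) && (x \in cover D2)].
  have [e1 e1C se1] := avoid s; exists e1, e2; split => //.
    by apply: contra cD1 => ce1; apply/bigcupP; exists e1.
  rewrite disjoint_subset; apply/subsetP => x xe1; rewrite inE; apply/negP => xe2.
  have x1 : x \in cover D1 by apply/bigcupP; exists e1.
  have x2 : x \in cover D2 by apply/bigcupP; exists e2.
  move: se1; rewrite /s; case: pickP => [s' /andP[s1' s2']|/(_ x)] /=.
    by rewrite (cycles_vertex_disjoint tc s1' s2' x1 x2) xe1.
  by rewrite x1 x2.
move=> tc; have [cC1|cC1] := boolP (c \in cover C1); last exact: aux.
have [cC2|cC2] := boolP (c \in cover C2); last first.
  have [e1 [e2 [? ? ? ? d]]] := aux _ _ (two_cycles_sym tc) cC2.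
  by exists e2, e1; split => //; rewrite disjoint_sym.
have [_ [c1 s1] [c2 s2] _] := tc.
have [e1 e1C ce1] := cycle_edge_avoid (cycle_card2 s1) c1 c.
have [e2 e2C ce2] := cycle_edge_avoid (cycle_card2 s2) c2 c.
exists e1, e2; split => //.
rewrite disjoint_subset; apply/subsetP => x xe1; rewrite inE; apply/negP => xe2.
have x1 : x \in cover C1 by apply/bigcupP; exists e1.
have x2 : x \in cover C2 by apply/bigcupP; exists e2.
by rewrite (cycles_vertex_disjoint tc cC1 cC2 x1 x2) xe1 in ce1.
Qed.

(** * Rooting a spanning tree at c *)

Section Parent.
Variables (D : {set {set T}}) (c : T).
Hypothesis sDE : D \subset E.
Hypothesis Dcon : forall x y, connect (gadj D) x y.
Hypothesis Dbridge : forall x y, [set x; y] \in D ->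
  ~~ connect (gadj (D :\ [set x; y])) x y.

Definition avoiding w := [set e in D | w \notin e].
(** The tree neighbour of w towards c, described without paths: c stays reachable from y when all
    edges at w are deleted. *)
Definition is_parent w y := gadj D w y && connect (gadj (avoiding w)) y c.
Definition parent w := odflt w [pick y | is_parent w y].

Lemma avoiding_sub w (e : {set T}) : w \in e -> avoiding w \subset D :\ e.
Proof.
move=> we; apply/subsetP => h; rewrite inE in_setD1 => /andP[hD wh].
by rewrite hD andbT; apply: contraNneq wh => ->.
Qed.

Lemma path_avoiding w y p : path (gadj D) y p -> w \notin y :: p ->
  connect (gadj (avoiding w)) y (last y p).
Proof.
elim: p y => [|z p IH] y //= /andP[/andP[nyz yz] pz].
rewrite !inE !negb_or => /and3P[wy wz wp].
apply: (@connect_trans _ _ z); last by apply: IH; rewrite // inE negb_or wz.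
by apply: connect1; rewrite /gadj nyz !inE yz negb_or wy wz.
Qed.

Lemma parent_exists w : w != c -> is_parent w (parent w).
Proof.
move=> nwc; rewrite /parent; case: pickP => //= H; exfalso.
have /connectP[q0 q0p q0c] := Dcon w c.
case/shortenP: q0p q0c => q qp uq _ qc {q0}.
case: q => [|y q] in qp uq qc *; first by rewrite qc eqxx in nwc.
move: qp uq => /= /andP[wy yq] /andP[wq _].
by move: (H y); rewrite /is_parent wy qc path_avoiding.
Qed.

(** Otherwise w would reach z through y and c without the edge w z, which is a bridge. *)
Lemma parent_unique w y z : is_parent w y -> is_parent w z -> y = z.
Proof.
move=> /andP[wy yc] /andP[wz zc]; apply/eqP; apply/negPn/negP => nyz.
have [nwy wyD] := andP wy; have [nwz wzD] := andP wz.
apply: (negP (Dbridge wzD)); apply: (@connect_trans _ _ y).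
  apply: connect1; rewrite /gadj nwy in_setD1 wyD andbT.
  by apply: contra nyz => /eqP /set2_inj ->.
apply: (@connect_trans _ _ c); first by
  apply: gconnect_sub yc; apply: avoiding_sub; rewrite set21.
by rewrite gconnect_sym; apply: gconnect_sub zc; apply: avoiding_sub; rewrite set21.
Qed.

Lemma parentE w y : is_parent w y -> parent w = y.
Proof.
move=> wy; rewrite /parent; case: pickP => [z wz|/(_ y)]; last by rewrite wy.
exact: (parent_unique wz wy).
Qed.

(** If two vertices were each the parent of the other, both would reach c without the edge between
    them, and it would not be a bridge. *)
Lemma parent_inj : {in [set~ c] &, injective (fun w => [set w; parent w])}.
Proof.
move=> w w'; rewrite !inE => wc wc' E0.
have [[-> //]|[wE pwE]] := set2_eq E0; exfalso.
have /andP[/andP[nw wD] pc] := parent_exists wc.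
have /andP[_ pc'] := parent_exists wc'.
apply: (negP (Dbridge wD)); apply: (@connect_trans _ _ c).
  rewrite -wE in pc'; apply: gconnect_sub pc'; apply: avoiding_sub.
  by rewrite pwE set22.
rewrite gconnect_sym; apply: gconnect_sub pc; apply: avoiding_sub.
by rewrite set21.
Qed.

(** For a tree edge u v, take a simple path from v to c. If it misses u, then v is the parent of u;
    otherwise its part from u on misses v, and u is the parent of v. *)
Lemma parent_edges : D = [set [set w; parent w] | w in [set~ c]].
Proof.
apply/setP => e; apply/idP/imsetP => [eD|[w]]; last first.
  by rewrite !inE => /parent_exists /andP[/andP[]] _ + _ ->.
have [u [v [nuv eE]]] := card2P (E2 (subsetP sDE _ eD)).
have uvD : gadj D u v by rewrite /gadj nuv -eE.
have vuD : gadj D v u by rewrite gadj_sym.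
case: (eqVneq u c) => [uc|nuc].
  exists v; first by rewrite !inE -uc eq_sym.
  by rewrite (@parentE v u) 1?[RHS]setUC // /is_parent vuD uc connect0.
case: (eqVneq v c) => [vc|nvc].
  exists u; first by rewrite !inE.
  by rewrite (@parentE u v) // /is_parent uvD vc connect0.
have /connectP[q0 q0p q0c] := Dcon v c.
case/shortenP: q0p q0c => q qp uq _ qc {q0}.
have [uq'|uq'] := boolP (u \in q); last first.
  exists u; first by rewrite !inE.
  by rewrite (@parentE u v) // /is_parent uvD qc path_avoiding // inE negb_or nuv.
exists v; first by rewrite !inE.
rewrite (@parentE v u) 1?[RHS]setUC // /is_parent vuD qc.
case/splitPr: uq' => q1 q2 in qp uq qc *.
rewrite last_cat /=; apply: path_avoiding.
  by move: qp; rewrite cat_path /= => /and3P[].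
by move: uq; rewrite /= mem_cat negb_or => /andP[/andP[]].
Qed.

End Parent.

(* The edges other than e1 = ab and e2 = df form a spanning tree, in which p v is
   the neighbour of v towards c.  The fourth condition says that no edge cut
   consists of e1, e2 and one tree edge. *)
Definition cactus_decomposition (c : T) (p : T -> T) (a b d f : T) :=
  [/\ uniq [:: c; a; b; d; f],
      E = [set [set v; p v] | v in [set~ c]] :|: [set [set a; b]; [set d; f]],
      {in [set~ c] &, injective (fun v => [set v; p v])},
      (forall v, v != c ->
        [&& v != p v, [set v; p v] != [set a; b] & [set v; p v] != [set d; f]]) &
      (forall (X : {set T}) (v0 : T),
        (a \in X) != (b \in X) -> (d \in X) != (f \in X) ->
        (forall v, v != c -> v != v0 -> (v \in X) = (p v \in X)) -> False) /\
      (forall (X : {set T}) v, (forall v, v != c -> (v \in X) = (p v \in X)) ->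
        v \in X -> c \in X)].

(** Each removed edge is bypassed by the rest of its cycle, so D stays connected; D contains neither
    cycle, so each of its edges is a bridge. *)
Lemma cactus_decomposition_exists C1 C2 c : two_cycles C1 C2 ->
  exists p a b d f, cactus_decomposition c p a b d f.
Proof.
move=> tc; have [_ [c1 s1] [c2 s2] _] := tc.
have [e1 [e2 [e1C e2C ce1 ce2 dis]]] := disjoint_cycle_edges c tc.
have disj h : h \in C1 -> h \in C2 -> False := cycles_edge_disjoint tc.
have e1E := subsetP s1 _ e1C; have e2E := subsetP s2 _ e2C.
have [a [b [nab e1ab]]] := card2P (E2 e1E).
have [d [f [ndf e2df]]] := card2P (E2 e2E).
subst e1 e2; set D := E :\ [set a; b] :\ [set d; f].
have sDE : D \subset E by apply/subsetP => h; rewrite !in_setD1 => /and3P[].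
have n12 : [set a; b] != [set d; f].
  by apply/eqP => e12; apply: (disj _ e1C); rewrite e12.
have con1 : connect (gadj D) a b.
  apply: gconnect_sub (cycle_edge_connect (cycle_card2 s1) c1 e1C).
  apply/subsetP => h; rewrite !in_setD1 => /andP[-> h1].
  rewrite (subsetP s1) // !andbT; apply/eqP => hE.
  by apply: (disj _ h1); rewrite hE.
have con2 : connect (gadj D) d f.
  apply: gconnect_sub (cycle_edge_connect (cycle_card2 s2) c2 e2C).
  apply/subsetP => h; rewrite !in_setD1 => /andP[-> h1].
  rewrite (subsetP s2) // !andbT; apply/eqP => hE.
  by apply: (disj [set a; b]) => //; rewrite -hE.
have Dcon x y : connect (gadj D) x y.
  apply: connect_sub (Econ x y) => u v /andP[nuv uvE].
  case: (eqVneq [set u; v] [set a; b]) => [|n1].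
    by move/set2_eq => [[-> ->]|[-> ->]] //; rewrite gconnect_sym.
  case: (eqVneq [set u; v] [set d; f]) => [|n2].
    by move/set2_eq => [[-> ->]|[-> ->]] //; rewrite gconnect_sym.
  by apply: connect1; rewrite /gadj nuv !in_setD1 n1 n2.
have Dbridge x y : [set x; y] \in D -> ~~ connect (gadj (D :\ [set x; y])) x y.
  move=> xyD; apply/negP => con.
  case: (two_cycles_through tc sDE xyD con) => -[/subsetP sub _].
    by have := sub _ e1C; rewrite !in_setD1 eqxx andbF.
  by have := sub _ e2C; rewrite !in_setD1 eqxx.
pose p := parent D c.
have DE : D = [set [set w; p w] | w in [set~ c]] := parent_edges c sDE Dcon Dbridge.
have pD v : v != c -> [set v; p v] \in D.
  by move=> vc; rewrite DE; apply/imsetP; exists v; rewrite // !inE.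
have EE : E = D :|: [set [set a; b]; [set d; f]].
  apply/setP => h; rewrite !inE; case: (eqVneq h [set a; b]) => [->|_] /=.
    by rewrite orbT.
  by case: (eqVneq h [set d; f]) => [->|_] //=; rewrite orbF.
exists p, a, b, d, f; split => //.
- move: ce1 ce2 dis; rewrite disjoint_subset => ce1 ce2 /subsetP dis.
  have := dis a (set21 _ _); have := dis b (set22 _ _).
  move: ce1 ce2; rewrite /= !inE !negb_or nab ndf => /andP[-> ->] /andP[-> ->].
  by move=> /andP[-> ->] /andP[-> ->].
- by rewrite -DE.
- exact: (parent_inj Dcon Dbridge).
- move=> v /pD; rewrite !in_setD1 => /and3P[-> -> /edge_neq ->].
  by [].
split; last first.
  move=> X v sX vX; rewrite -(gconnect_cut (Dcon v c)) // => x y.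
  rewrite DE => /imsetP[w]; rewrite !inE => wc /set2_eq [[-> ->]|[-> ->]].
    exact: sX.
  exact/esym/sX.
move=> X v0 Xab Xdf Xv.
(* A cycle that crosses the cut at e crosses it again, hence at v0 p(v0). *)
have cross C g x y : C \subset E -> is_loose_cycle C -> [set x; y] \in C ->
    (x \in X) != (y \in X) ->
    E = D :|: [set [set x; y]; g] -> g \notin C -> [set v0; p v0] \in C.
  move=> CE cC xyC Xxy Eg gC; apply/negPn/negP => v0C.
  move/negP: Xxy; apply; apply/eqP.
  apply: (gconnect_cut (cycle_edge_connect (cycle_card2 CE) cC xyC)) => u v.
  rewrite in_setD1 => /andP[nuv uvC].
  have := subsetP CE _ uvC; rewrite Eg in_setU in_set2 (negPf nuv) /=.
  case: eqP => [uvg|_]; first by rewrite -uvg uvC in gC.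
  rewrite orbF DE => /imsetP[w]; rewrite !inE => wc uvE.
  have nw : w != v0 by apply: contraNneq v0C => <-; rewrite -uvE.
  by have := set2_eq uvE => -[[-> ->]|[-> ->]]; [|apply/esym]; apply: Xv.
(* Both cycles would contain the edge v0 p(v0), although they are edge-disjoint. *)
apply: (disj [set v0; p v0]).
  apply: (cross C1 [set d; f] a b) => //.
  by apply/negP => /disj; apply.
apply: (cross C2 [set a; b] d f) => //.
  by rewrite EE; congr (_ :|: _); rewrite setUC.
by apply/negP => /(disj _ e1C).
Qed.

End TwoCycles.

(** * Power hypergraphs and isomorphisms *)

Lemma hg_iso_sym H K : hg_iso H K -> hg_iso K H.
Proof.
move=> [f [g fK gK] E]; exists g; first by exists f.
rewrite -E -imset_comp -[RHS]imset_id; apply: eq_imset => e /=.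
by rewrite -imset_comp (eq_imset _ fK) imset_id.
Qed.

Lemma hg_iso_trans H K L : hg_iso H K -> hg_iso K L -> hg_iso H L.
Proof.
move=> [f bf Ef] [g bg Eg]; exists (g \o f); first exact: bij_comp.
rewrite -Eg -Ef -imset_comp; apply: eq_imset => e /=.
by rewrite imset_comp.
Qed.

Lemma hg_iso_linear H K : hg_iso H K -> linear_hg K -> linear_hg H.
Proof.
move=> [f bf Ef] lin e1 e2 e1H e2H n12.
have f_inj := bij_inj bf.
rewrite -(card_imset _ f_inj) imsetI; last by move=> ? ? _ _; apply: f_inj.
apply: lin; rewrite -?Ef ?imset_f //.
by apply: contra n12 => /eqP /(imset_inj f_inj) ->.
Qed.

(** * Loose cycles under a map of edges *)

Section CycleTransport.
Variables (T T' : finType) (E : {set {set T}}).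
Variables (Phi : {set T} -> {set T'}) (g : T -> T').
Hypotheses (g_inj : injective g) (Phi_inj : {in E &, injective Phi}).
Hypothesis PhiI : forall e f, e \in E -> f \in E -> e != f ->
  Phi e :&: Phi f = g @: (e :&: f).
Hypothesis cardE : forall e, e \in E -> (1 < #|e|)%N.
Hypothesis card_Phi : forall e, e \in E -> (1 < #|Phi e|)%N.

(** Being a loose cycle depends only on the intersections of distinct edges, which [Phi] preserves
    up to g. Edges with more than one vertex guarantee that the edges compared are distinct, so that
    [PhiI] applies. *)
Lemma loose_cycle_imset (C : {set {set T}}) : C \subset E -> is_loose_cycle C ->
  is_loose_cycle (Phi @: C).
Proof.
move=> /subsetP sCE [l [e [v [l3 v_inj CE cap dis]]]].
have eE i : e i \in E by apply: sCE; rewrite CE imset_f.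
exists l, (Phi \o e), (g \o v); split => //.
- exact: inj_comp.
- by rewrite CE -imset_comp.
- move=> i /=; rewrite PhiI // ?cap ?imset_set1 //.
  apply: contraTneq (cardE (eE i)) => ee; have := cap i.
  by rewrite ee setIid => ->; rewrite cards1.
- move=> i j n1 n2 n3 /=; rewrite PhiI ?dis ?imset0 //.
  apply: contraTneq (cardE (eE i)) => ee; have := dis i j n1 n2 n3.
  by rewrite -ee setIid => ->; rewrite cards0.
Qed.

(** The core vertices of the image cycle lie in intersections of two edges, hence in the range of g,
    and can be pulled back. *)
Lemma loose_cycle_imset_inv (C : {set {set T}}) : C \subset E -> is_loose_cycle (Phi @: C) ->
  is_loose_cycle C.
Proof.
move=> /subsetP sCE [l [e' [v' [l3 v_inj CE cap dis]]]].
have /fin_all_exists[e eP] i : exists e, e \in C /\ e' i = Phi e.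
  have : e' i \in Phi @: C by rewrite CE imset_f.
  by case/imsetP => e eC ->; exists e.
have eE i : e i \in E by apply: sCE; case: (eP i).
have e'E i : e' i = Phi (e i) by case: (eP i).
have nee i : e (ord_pred i) != e i.
  apply: contraTneq (card_Phi (eE i)) => ee; have := cap i.
  by rewrite !e'E ee setIid => ->; rewrite cards1.
have capg i : g @: (e (ord_pred i) :&: e i) = [set v' i].
  by rewrite -PhiI // -!e'E.
have /fin_all_exists[v vP] i : exists v, e (ord_pred i) :&: e i = [set v] /\ v' i = g v.
  have : v' i \in g @: (e (ord_pred i) :&: e i) by rewrite capg set11.
  case/imsetP => v vi v'E; exists v; split => //.
  by apply: (imset_inj g_inj); rewrite capg imset_set1 v'E.
exists l, e, v; split => //.
- move=> i j vij; apply: v_inj.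
  by case: (vP i) => _ ->; case: (vP j) => _ ->; rewrite vij.
- apply/setP => h; apply/idP/imsetP => [hC|[i _ ->]]; last by case: (eP i).
  have : Phi h \in Phi @: C by rewrite imset_f.
  rewrite CE => /imsetP[i _ hE]; exists i => //.
  by apply: Phi_inj => //; [apply: sCE | rewrite hE e'E].
- by move=> i; case: (vP i).
- move=> i j n1 n2 n3; have := dis i j n1 n2 n3; rewrite !e'E.
  have [ee|ne] := eqVneq (e i) (e j).
    rewrite ee setIid => e0; have := card_Phi (eE j).
    by rewrite e0 cards0.
  rewrite PhiI // => /eqP; rewrite imset_eq0 => /eqP //.
Qed.

End CycleTransport.

(** * The power of a graph *)

Section PowerHypergraph.
Variables (m : nat) (G : hypergraph).
Hypothesis G2 : uniform 2 G.
Local Notation sigE := {e : {set G} | e \in edges G}.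
Local Notation K := (power m G).

Lemma inl_power_edge (e : sigE) (x : G) :
  (inl x \in @power_edge m G e) = (x \in val e).
Proof.
rewrite !inE mem_imset; last by move=> ? ? [].
by rewrite orbC; case: imsetP => [[]//|].
Qed.

Lemma inr_power_edge (e e' : sigE) (j : 'I_(m - 2)) :
  (inr (e', j) \in @power_edge m G e) = (e' == e).
Proof.
rewrite !inE; case: imsetP => [[]//|_] /=.
by apply/imsetP/eqP => [[k _ [-> _]] //|->]; exists j.
Qed.

Lemma power_edge_inj : injective (@power_edge m G).
Proof.
move=> e e' E; apply/val_inj/setP => x.
by rewrite -!inl_power_edge E.
Qed.

Lemma power_edgeI e e' : e != e' ->
  @power_edge m G e :&: @power_edge m G e' = [set inl x | x in val e :&: val e'].
Proof.
move=> ne; apply/setP => -[x|[h j]].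
  by rewrite in_setI !inl_power_edge mem_imset ?in_setI // => ? ? [].
rewrite in_setI !inr_power_edge; case: imsetP => [[]//|_].
by case: eqP => //= ->; apply/negbTE.
Qed.

Lemma graph_linear : linear_hg G.
Proof.
move=> e f eG fG nef; rewrite leqNgt; apply: contra nef => lt.
have sub1 : e :&: f \subset e by apply: subsetIl.
have sub2 : e :&: f \subset f by apply: subsetIr.
have e1 : e :&: f = e by apply/eqP; rewrite eqEcard sub1 (G2 eG).
have e2 : e :&: f = f by apply/eqP; rewrite eqEcard sub2 (G2 fG).
by apply/eqP; rewrite -[LHS]e1 [LHS]e2.
Qed.

Lemma power_linear : linear_hg K.
Proof.
move=> _ _ /imsetP[e _ ->] /imsetP[f _ ->] ne.
have nef : e != f by apply: contraNneq ne => ->.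
rewrite power_edgeI // card_imset; last by move=> ? ? [].
by apply: graph_linear; rewrite ?(valP e) ?(valP f).
Qed.

Lemma card_power_edges : #|edges K| = #|edges G|.
Proof.
rewrite card_imset; last exact: power_edge_inj.
by rewrite card_sig.
Qed.

Lemma power_edge_vertex (e : sigE) : exists x, x \in val e.
Proof. by apply/set0Pn; apply: contraNneq (edges_neq0 G) => <-; apply: valP. Qed.

(** An added vertex of e goes to some end of e, so that adjacent vertices of the power become equal
    or adjacent in G. *)
Definition power_proj (x : power_vertex m G) : G :=
  match x with inl u => u | inr (e, _) => xchoose (power_edge_vertex e) end.

Lemma power_proj_edge e x : x \in @power_edge m G e -> power_proj x \in val e.
Proof.
case: x => [u|[h j]]; first by rewrite inl_power_edge.
rewrite inr_power_edge => /eqP <- /=; exact: xchooseP.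
Qed.

Lemma connected_power : connected_hg K -> forall x y, connect (gadj (edges G)) x y.
Proof.
move=> con x y.
suff H (u v : K) : connect (gadj (edges G)) (power_proj u) (power_proj v).
  exact: (H (inl x) (inl y)).
have /connectP[p] := con u v.
elim: p u => [|z p IH] u /=; first by move=> _ ->.
move=> /andP[/andP[nuz /existsP[e /and3P[eK ue ze]]] pz] yE.
apply: (connect_trans _ (IH z pz yE)).
move: eK => /imsetP[h _ eE]; rewrite eE in ue ze.
have [->//|npr] := eqVneq (power_proj u) (power_proj z).
apply: connect1; rewrite /gadj npr.
suff -> : [set power_proj u; power_proj z] = val h by apply: (valP h).
apply/eqP; rewrite eqEcard cards2 npr (G2 (valP h)) andbT.
by apply/subsetP => s; rewrite !inE => /orP[]/eqP->; apply: power_proj_edge.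
Qed.

End PowerHypergraph.

Lemma bicyclic_two_cycles m G H : uniform 2 G -> (1 < m)%N -> uniform m H ->
  hg_iso H (power m G) -> bicyclic H -> exists C1 C2, two_cycles (edges G) C1 C2.
Proof.
move=> G2 m1 Hm [f [g fg gf] Ef].
(* [power_edge] expects an edge together with its membership proof; [pedge] extends it to all sets
   of vertices, so that images of edge sets can be formed. *)
pose pedge (e : {set G}) : {set power_vertex m G} := [set inl x | x in e] :|:
  [set inr p | p : {e : {set G} | e \in edges G} * 'I_(m - 2) & val p.1 == e].
pose Phi (e : {set G}) : {set H} := g @: pedge e.
have g_inj : injective g := can_inj gf.
have PhiE (e : {e : {set G} | e \in edges G}) : Phi (val e) = g @: @power_edge m G e.
  rewrite /Phi (_ : pedge _ = @power_edge m G e) //; apply/setP => -[x|[h j]].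
    rewrite inl_power_edge !inE mem_imset; last by move=> ? ? [].
    by rewrite orbC; case: imsetP => [[]//|].
  rewrite inr_power_edge !inE; case: imsetP => [[]//|_] /=.
  apply/imsetP/eqP => [[[h' j'] /= + [-> _]]|->]; last by exists (e, j); rewrite ?inE.
  by rewrite inE => /eqP /val_inj.
have edgesH : edges H = Phi @: edges G.
  have -> : edges H = [set g @: e | e : {set power m G} in edges (power m G)].
    rewrite -Ef -imset_comp -[LHS]imset_id; apply: eq_imset => e /=.
    by rewrite -imset_comp (eq_imset _ fg) imset_id.
  apply/setP => h; apply/imsetP/imsetP => [[_ /imsetP[e _ ->] ->]|[e eG ->]].
    by exists (val e); rewrite ?(valP e) ?PhiE.
  by exists (@power_edge m G (Sub e eG)); rewrite ?imset_f // -PhiE.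
have PhiI e e' : e \in edges G -> e' \in edges G -> e != e' ->
    Phi e :&: Phi e' = (g \o inl) @: (e :&: e').
  move=> eG e'G ne.
  rewrite (PhiE (exist _ e eG)) (PhiE (exist _ e' e'G)).
  rewrite -imsetI; last by move=> ? ? _ _; apply: g_inj.
  by rewrite power_edgeI // [RHS]imset_comp.
have Phi_inj : {in edges G &, injective Phi}.
  move=> e e' eG e'G.
  rewrite (PhiE (exist _ e eG)) (PhiE (exist _ e' e'G)).
  by move=> /(imset_inj g_inj) /power_edge_inj /(congr1 val).
have gl_inj : injective (g \o (inl : G -> power_vertex m G)).
  by apply: inj_comp => // ? ? [].
have cardG e : e \in edges G -> (1 < #|e|)%N by move/G2 ->.
have cardH e : e \in edges G -> (1 < #|Phi e|)%N.
  by move=> eG; rewrite Hm // edgesH imset_f.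
have lift (C : {set {set G}}) : C \subset edges G -> is_loose_cycle C -> is_loose_cycle (Phi @: C).
  exact: (loose_cycle_imset gl_inj PhiI).
have unlift (C : {set {set G}}) : C \subset edges G -> is_loose_cycle (Phi @: C) -> is_loose_cycle C.
  exact: (loose_cycle_imset_inv gl_inj Phi_inj PhiI).
rewrite /bicyclic => /eqP /cards2P[D1 [D2 [nD DE]]].
have pre (D : {set {set H}}) : D \subset edges H -> is_loose_cycle D ->
    exists C : {set {set G}}, [/\ C \subset edges G, is_loose_cycle C & D = Phi @: C].
  move=> sD cD; exists [set e in edges G | Phi e \in D].
  have sC : [set e in edges G | Phi e \in D] \subset edges G.
    by apply/subsetP => e; rewrite inE => /andP[].
  have DC : D = Phi @: [set e in edges G | Phi e \in D].
    apply/setP => h; apply/idP/imsetP => [hD|[e + ->]]; last by rewrite inE => /andP[].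
    have := subsetP sD _ hD; rewrite edgesH => /imsetP[e eG hE].
    by exists e => //; rewrite inE eG -hE.
  by split => //; apply: unlift; rewrite -?DC.
have in1 : D1 \in [set D1; D2] by rewrite set21.
have in2 : D2 \in [set D1; D2] by rewrite set22.
move: in1 in2; rewrite -DE !inE => /andP[s1 /asboolP c1] /andP[s2 /asboolP c2].
have [C1 [sC1 cC1 D1E]] := pre _ s1 c1.
have [C2 [sC2 cC2 D2E]] := pre _ s2 c2.
exists C1, C2; split => //.
  by apply: contraNneq nD => C12; rewrite D1E D2E C12.
move=> C cC sC.
have : Phi @: C \in [set D1; D2].
  rewrite -DE inE; apply/andP; split; last by apply/asboolP; apply: lift.
  by rewrite edgesH; apply: imsetS.
have back (C0 C' : {set {set G}}) : C0 \subset edges G -> C' \subset edges G ->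
    Phi @: C0 = Phi @: C' -> C0 = C'.
  move=> /subsetP s0 /subsetP s' E0; apply/setP => e; apply/idP/idP => eC.
    have : Phi e \in Phi @: C' by rewrite -E0 imset_f.
    by case/imsetP => e' e'C /Phi_inj ->; [|apply: s0|apply: s'].
  have : Phi e \in Phi @: C0 by rewrite E0 imset_f.
  by case/imsetP => e' e'C /Phi_inj ->; [|apply: s'|apply: s0].
by rewrite in_set2 D1E D2E => /orP[]/eqP /back; [left|right]; auto.
Qed.

(* H is obtained from the graph with edges eG i, up to isomorphism, by
   enlarging each eG i to eH i with m - 2 vertices that lie in no other edge. *)
Record presents (m : nat) (V I : finType) (eG : I -> {set V}) (H : hypergraph)
    (g : V -> H) (eH : I -> {set H}) : Prop := {
  presents_edges : edges H = [set eH i | i : I];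
  presents_inj : injective g;
  presents_mem : forall i u, (g u \in eH i) = (u \in eG i);
  presents_card : forall i, #|eH i| = m;
  presents_private : forall h, (forall u, h != g u) ->
    exists i, forall j, (h \in eH j) = (j == i) }.

Lemma card_power_edge m (G : hypergraph) (e : {e : {set G} | e \in edges G}) :
  uniform 2 G -> 1 < m -> #|@power_edge m G e| = m.
Proof.
move=> G2 m1; rewrite cardsU card_imset; last by move=> ? ? [].
rewrite card_imset; last by move=> ? ? [].
rewrite (G2 _ (valP e)) card_ord (_ : _ :&: _ = set0) ?cards0; first by lia.
by apply/setP => x; rewrite !inE; apply/negP => /andP[/imsetP[? _ ->] /imsetP[]].
Qed.

(** Each [eH i] has exactly m - 2 vertices outside the range of g, and none of them lies in another
    edge; any enumeration of them matches the added vertices of the power. *)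
Lemma presents_power_iso m (G H : hypergraph) (I : finType) (eG : I -> {set G})
    (g : G -> H) (eH : I -> {set H}) :
  1 < m -> uniform 2 G -> edges G = [set eG i | i : I] -> injective eG ->
  presents m eG g eH -> hg_iso H (power m G).
Proof.
move=> m1 G2 GE eG_inj [HE g_inj mem_g card_eH priv]; apply: hg_iso_sym.
pose P i := eH i :\: [set g u | u : G].
have PE i h : (h \in P i) = (h \in eH i) && [forall u, h != g u].
  rewrite inE andbC; congr (_ && _); apply/idP/forallP => [/imsetP hg u|hg].
    by apply/eqP => hE; apply: hg; exists u.
  by apply/imsetP => -[u _ hE]; have := hg u; rewrite hE eqxx.
have cardP i : #|P i| = m - 2.
  rewrite cardsD card_eH; congr (_ - _).
  have -> : eH i :&: [set g u | u : G] = g @: eG i.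
    apply/setP => h; rewrite inE; apply/andP/imsetP => [[hi /imsetP[u _ hE]]|[u ui ->]].
      by exists u => //; rewrite -mem_g -hE.
    by rewrite mem_g imset_f.
  by rewrite card_imset // G2 // GE imset_f.
have idxP (e : {e : {set G} | e \in edges G}) : exists i, val e == eG i.
  have : val e \in [set eG i | i : I] by rewrite -GE; apply: valP.
  by case/imsetP => i _ ->; exists i.
pose idx e := xchoose (idxP e).
have idxE e : eG (idx e) = val e by apply/esym/eqP; apply: (xchooseP (idxP e)).
pose F (x : power m G) : H := match x with
  | inl u => g u
  | inr (e, j) => enum_val (cast_ord (esym (cardP (idx e))) j) end.
have FP e j : F (inr (e, j)) \in P (idx e) by apply: enum_valP.
have Fcore u e j : g u != F (inr (e, j)).
  by have := FP e j; rewrite PE eq_sym => /andP[_ /forallP].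
have F_inj : injective F.
  move=> [u|[e j]] [u'|[e' j']] E.
  - by rewrite (g_inj _ _ E).
  - by have := Fcore u e' j'; rewrite -E eqxx.
  - by have := Fcore u' e j; rewrite E eqxx.
  - have Fe := FP e j; have := FP e' j'; rewrite -E => Fe'.
    have ee : e' = e.
      move: Fe Fe'; rewrite !PE => /andP[h1 /forallP /priv[i iP]] /andP[h2 _].
      apply: val_inj; rewrite -!idxE; congr eG.
      by move: h1 h2; rewrite !iP => /eqP -> /eqP ->.
    subst e'; congr (inr (_, _)).
    by apply: (@cast_ord_inj _ _ (esym (cardP (idx e)))); apply: enum_val_inj.
have F_onto h : h \in codom F.
  have [/existsP[u /eqP ->]|] := boolP [exists u, h == g u].
    by apply/codomP; exists (inl u).
  rewrite negb_exists => hg; have [i iP] := priv h (forallP hg).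
  have eGi : eG i \in edges G by rewrite GE imset_f.
  pose ei : {e : {set G} | e \in edges G} := exist _ (eG i) eGi.
  have ii : idx ei = i by apply: eG_inj; rewrite idxE.
  have hP : h \in P (idx ei) by rewrite ii PE iP eqxx.
  apply/codomP; exists (inr (ei, cast_ord (cardP _) (enum_rank_in hP h))).
  by rewrite /= cast_ordK enum_rankK_in.
exists F.
  apply: (inj_card_bij F_inj); apply: leq_trans (leq_image_card F predT).
  by apply/subset_leq_card/subsetP => h _; apply: F_onto.
have FE e : F @: @power_edge m G e = eH (idx e).
  apply/eqP; rewrite eqEcard card_imset // card_power_edge // card_eH leqnn andbT.
  apply/subsetP => _ /imsetP[[u|[e' j]] + ->].
    by rewrite inl_power_edge /= mem_g idxE.
  by rewrite inr_power_edge => /eqP ->; have := FP e j; rewrite PE => /andP[].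
rewrite HE; apply/setP => h; apply/imsetP/imsetP => [[_ /imsetP[e _ ->] ->]|[i _ ->]].
  by exists (idx e).
have eGi : eG i \in edges G by rewrite GE imset_f.
pose ei : {e : {set G} | e \in edges G} := exist _ (eG i) eGi.
exists (@power_edge m G ei); first exact: imset_f.
by rewrite FE; congr eH; apply: eG_inj; rewrite idxE.
Qed.

Lemma mem_inl_imset (A B : finType) (X : {set A}) (a : A) :
  (inl a \in [set (inl x : A + B) | x in X]) = (a \in X).
Proof. by rewrite mem_imset // => ? ? []. Qed.

Lemma mem_inr_imset (A B : finType) (X : {set A}) (b : B) :
  (inr b \in [set (inl x : A + B) | x in X]) = false.
Proof. by apply/imsetP => -[]. Qed.

Lemma imset_sum (A B C : finType) (F : A + B -> C) :
  [set F x | x : A + B] = [set F (inl a) | a : A] :|: [set F (inr b) | b : B].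
Proof.
apply/setP => y; rewrite inE; apply/imsetP/orP => [[[a|b] _ ->]|[/imsetP[a _ ->]|/imsetP[b _ ->]]].
- by left; apply: imset_f.
- by right; apply: imset_f.
- by exists (inl a).
- by exists (inr b).
Qed.

(** * Presentations after attaching pendant edges *)

Section Attach.
Variables (m n : nat) (V I : finType) (eG : I -> {set V}) (H : hypergraph).
Variables (g : V -> H) (eH : I -> {set H}) (v : V).
Hypothesis m1 : 0 < m - 1.
Hypothesis pr : presents m eG g eH.

Definition attach_graph_edge (i : I + 'I_n) : {set V + 'I_n} :=
  match i with
  | inl i => [set inl u | u in eG i]
  | inr k => [set inl v; inr k]
  end.

(** Of the m - 1 new vertices of a pendant edge, the one with index 0 is the end of the graph edge;
    the other m - 2 are the added ones. *)
Definition attach_core (u : V + 'I_n) : @attach_pendants m n H (g v) :=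
  match u with inl u => inl (g u) | inr k => inr (k, Ordinal m1) end.

Definition attach_edge (i : I + 'I_n) : {set @attach_pendants m n H (g v)} :=
  match i with
  | inl i => [set inl x | x in eH i]
  | inr k => @pendant_edge m n H (g v) k
  end.

Lemma inl_pendant_edge (x : H) k :
  (inl x \in @pendant_edge m n H (g v) k) = (x == g v).
Proof. by rewrite !inE; case: imsetP => [[]//|_]; rewrite orbF. Qed.

Lemma inr_pendant_edge p k : (inr p \in @pendant_edge m n H (g v) k) = (p.1 == k).
Proof.
rewrite !inE /=; apply/imsetP/eqP => [[j _ [->]] //|<-].
by exists p.2 => //; case: p.
Qed.

Lemma presents_attach : presents m attach_graph_edge attach_core attach_edge.
Proof.
case: pr => [HE g_inj mem_g card_eH priv]; split.
- rewrite /= /pendant_edges HE imset_sum; congr (_ :|: _).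
  by rewrite -imset_comp.
- by move=> [u|k] [u'|k'] //= []; [move/g_inj-> | move->].
- move=> [i|k] [u|k'] /=.
  + by rewrite !mem_inl_imset mem_g.
  + by rewrite !mem_inr_imset.
  + by rewrite inl_pendant_edge !inE (inj_eq g_inj) orbF.
  + by rewrite inr_pendant_edge !inE /=.
- move=> [i|k] /=; first by rewrite card_imset ?card_eH // => ? ? [].
  rewrite cardsU1 card_imset ?card_ord; last by move=> ? ? [].
  by case: imsetP => [[]//|_] /=; lia.
- move=> [x|[k j]] nx.
    have [u|i iP] := priv x; first by have := nx (inl u); apply: contra => /eqP ->.
    exists (inl i) => -[i'|k] /=; first by rewrite mem_inl_imset iP.
    by rewrite inl_pendant_edge; apply/negbTE; apply: contra (nx (inl v)) => /eqP ->.
  exists (inr k) => -[i'|k'] /=; first by rewrite mem_inr_imset.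
  by rewrite inr_pendant_edge /= eq_sym.
Qed.

Lemma attach_graph_edge_inj : injective eG -> injective attach_graph_edge.
Proof.
move=> eG_inj [i|k] [i'|k'] /= E.
- congr inl; apply: eG_inj; apply/setP => u.
  by have /setP/(_ (inl u)) := E; rewrite !mem_inl_imset.
- by have /setP/(_ (inr k')) := E; rewrite mem_inr_imset !inE eqxx orbT.
- by have /setP/(_ (inr k)) := E; rewrite mem_inr_imset !inE eqxx orbT.
- have /setP/(_ (inr k)) := E; rewrite !inE eqxx /= => /esym/eqP [->] //.
Qed.

End Attach.

Section CoalesceMembership.
Variables (H1 H2 : hypergraph) (u1 : H1) (u2 : H2).

Lemma inl_coalesce_imset (x : H1) (A : {set H2}) :
  (inl x \in [set coalesce_in2 u1 u2 y | y in A]) = (x == u1) && (u2 \in A).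
Proof.
apply/imsetP/andP => [[y yA]|[/eqP -> u2A]].
  rewrite /coalesce_in2; case: insubP => [//|]; rewrite negbK => /eqP yu [->].
  by rewrite eqxx -yu.
by exists u2 => //; rewrite /coalesce_in2 insubF ?eqxx.
Qed.

Lemma inr_coalesce_imset (y : {y : H2 | y != u2}) (A : {set H2}) :
  (inr y \in [set coalesce_in2 u1 u2 y | y in A]) = (val y \in A).
Proof.
apply/imsetP/idP => [[z zA]|yA].
  by rewrite /coalesce_in2; case: insubP => [z' _ zE [->]|//]; rewrite zE.
by exists (val y) => //; rewrite /coalesce_in2 valK.
Qed.

Lemma coalesce_in2_inj : injective (@coalesce_in2 H1 H2 u1 u2).
Proof.
move=> x y; rewrite /coalesce_in2.
case: insubP => [x' _ <-|]; case: insubP => [y' _ <-|]; rewrite ?negbK.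
- by case=> ->.
- by [].
- by [].
- by move=> /eqP -> /eqP ->.
Qed.

End CoalesceMembership.

(** * The two triangles with a common vertex *)

Section TwoTriangles.
Variable m : nat.
Hypothesis m1 : 1 < m.

(** The five core vertices form ['I_3 + 'I_2]: the identified vertex is [inl ord0], and core vertex
    j + 1 of the second cycle is [inr j]. *)
Definition second_core (i : 'I_3) : 'I_3 + 'I_2 :=
  if unlift ord0 i is Some j then inr j else inl ord0.

Definition triangles_graph_edge (i : 'I_3 + 'I_3) : {set 'I_3 + 'I_2} :=
  match i with
  | inl i => [set inl i; inl (ordS i)]
  | inr i => [set second_core i; second_core (ordS i)]
  end.

Lemma core_lift_neq (j : 'I_2) : core m (lift ord0 j) != core m ord0.
Proof. by []. Qed.

Definition triangles_core (u : 'I_3 + 'I_2) : two_triangles m :=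
  match u with
  | inl i => inl (core m i)
  | inr j => inr (exist _ (core m (lift ord0 j)) (core_lift_neq j))
  end.

Definition triangles_edge (i : 'I_3 + 'I_3) : {set two_triangles m} :=
  match i with
  | inl i => [set inl x | x in loose_cycle_edge m i]
  | inr i => [set @coalesce_in2 (loose_cycle m 3) (loose_cycle m 3)
                (core m ord0) (core m ord0) y | y in loose_cycle_edge m i]
  end.

Lemma ordS3_neq (i : 'I_3) : ordS i != i.
Proof. by case: i => [[|[|[]]] ?]. Qed.

Lemma inl_loose_cycle_edge (i j : 'I_3) :
  (inl j \in loose_cycle_edge m i) = (j == i) || (j == ordS i).
Proof. by rewrite !inE; case: imsetP => [[]//|_]; rewrite orbF. Qed.

Lemma inr_loose_cycle_edge (i : 'I_3) p :
  (inr p \in loose_cycle_edge m i) = (p.1 == i).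
Proof.
rewrite !inE /=; apply/imsetP/eqP => [[j _ [->]] //|<-].
by exists p.2 => //; case: p.
Qed.

Lemma card_loose_cycle_edge (i : 'I_3) : #|loose_cycle_edge m i| = m.
Proof.
rewrite /loose_cycle_edge cardsU cards2 card_imset ?card_ord; last by move=> ? ? [].
rewrite (_ : _ :&: _ = set0) ?cards0; last first.
  by apply/setP => x; rewrite !inE; apply/negP => /andP[/orP[]/eqP-> /imsetP[]].
have -> : (inl i != inl (ordS i) :> loose_cycle_vertex m 3) by
  apply/eqP => -[] E; have := ordS3_neq i; rewrite -E eqxx.
by lia.
Qed.

Lemma inl_second_core i j : (inl j == second_core i) = (j == ord0) && (i == ord0).
Proof. by rewrite /second_core; case: unliftP => [k ->|->]; rewrite ?andbF ?andbT. Qed.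

Lemma inr_second_core i j : (inr j == second_core i) = (lift ord0 j == i).
Proof.
rewrite /second_core; case: unliftP => [k ->|->] //; exact/esym/inj_eq/lift_inj.
Qed.

Lemma second_core_inj : injective second_core.
Proof.
move=> i j; rewrite /second_core.
by case: unliftP => [k ->|->]; case: unliftP => [k' ->|->] // [->].
Qed.

Lemma presents_two_triangles :
  presents m triangles_graph_edge triangles_core triangles_edge.
Proof.
split.
- by rewrite /= /coalesce_edges imset_sum -!imset_comp.
- by move=> [i|j] [i'|j'] //= []; [move=> -> | move/val_inj ->].
- move=> [i|i] [j|j] /=.
  + by rewrite mem_inl_imset inl_loose_cycle_edge !inE.
  + by rewrite mem_inr_imset !inE.
  + rewrite [LHS]inl_coalesce_imset inl_loose_cycle_edge !inE !inl_second_core.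
    by rewrite -andb_orr; congr (_ && (_ || _)); rewrite eq_sym.
  + by rewrite [LHS]inr_coalesce_imset inl_loose_cycle_edge !inE !inr_second_core.
- move=> [i|i] /=; rewrite card_imset ?card_loose_cycle_edge //.
    by move=> ? ? [].
  exact: coalesce_in2_inj.
- move=> [[i|[k j]]|[[i|[k j]] ny]] nh.
  + by have := nh (inl i); rewrite eqxx.
  + exists (inl k) => -[i'|i'] /=.
      by rewrite mem_inl_imset inr_loose_cycle_edge /= eq_sym.
    by rewrite [LHS]inl_coalesce_imset.
  + case: (unliftP ord0 i) => [j iE|iE]; last by exfalso; move: (ny); rewrite iE eqxx.
    have := nh (inr j); rewrite /= => /eqP []; congr inr; apply: val_inj.
    by rewrite /= iE.
  + exists (inr k) => -[i'|i'] /=; first by rewrite mem_inr_imset.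
    by rewrite [LHS]inr_coalesce_imset inr_loose_cycle_edge /= eq_sym.
Qed.

Lemma ordS3_asym (i j : 'I_3) : i = ordS j -> ordS i = j -> False.
Proof.
move=> -> /(congr1 val) /=.
by case: j => [[|[|[]]] ?].
Qed.

Lemma triangles_graph_edge_inj : injective triangles_graph_edge.
Proof.
have cross i j : triangles_graph_edge (inl i) != triangles_graph_edge (inr j).
  apply/eqP => /setP E; have := E (inl i); have := E (inl (ordS i)).
  rewrite !inE !eqxx orbT /= !inl_second_core => /esym.
  rewrite -andb_orr => /andP[/eqP Si _] /esym.
  by rewrite -andb_orr => /andP[/eqP i0 _]; have := ordS3_neq i; rewrite Si i0.
have one (k : 'I_3 -> 'I_3 + 'I_2) i j : injective k ->
    [set k i; k (ordS i)] = [set k j; k (ordS j)] -> i = j.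
  move=> k_inj /set2_eq [[/k_inj //]|[/k_inj ij /k_inj ji]].
  by case: (ordS3_asym ij ji).
move=> [i|i] [j|j] E.
- by congr inl; apply: (one inl) E => ? ? [].
- by have := cross i j; rewrite E eqxx.
- by have := cross j i; rewrite E eqxx.
- by congr inr; apply: (one second_core) E; apply: second_core_inj.
Qed.

End TwoTriangles.

(** The parent map of a tree rooted at c in which w hangs at y and all other vertices at c. *)
Definition star (T : eqType) (c w y : T) : T -> T := fun v => if v == w then y else c.

(* The graph underlying B2C _ _ 1: triangles c a b and c d f, one pendant edge
   w a, and all other vertices pendant at c. *)
Definition star_shape (T : finType) (E : {set {set T}}) (c a b d f w : T) :=
  uniq [:: c; a; b; d; f; w] /\
  E = [set [set v; star c w a v] | v in [set~ c]] :|: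
        [set [set a; b]; [set d; f]].

Section PowerIso.
Variables (m : nat) (G1 G2 : hypergraph) (f : G1 -> G2).
Hypothesis Ef : [set f @: e | e : {set G1} in edges G1] = edges G2.

Lemma imset_edge (e : {e : {set G1} | e \in edges G1}) : f @: val e \in edges G2.
Proof. by rewrite -Ef imset_f // (valP e). Qed.

Definition power_map (x : power m G1) : power m G2 :=
  match x with
  | inl u => inl (f u)
  | inr (e, j) => inr (exist _ (f @: val e) (imset_edge e), j)
  end.

End PowerIso.

Lemma power_iso m G1 G2 : hg_iso G1 G2 -> hg_iso (power m G1) (power m G2).
Proof.
move=> [f [g fg gf] Ef].
have Eg : [set g @: e | e : {set G2} in edges G2] = edges G1.
  rewrite -Ef -imset_comp -[RHS]imset_id; apply: eq_imset => e /=.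
  by rewrite -imset_comp (eq_imset _ fg) imset_id.
have cancel_map (K L : hypergraph) (h : K -> L) (h' : L -> K)
    (Eh : [set h @: e | e : {set K} in edges K] = edges L)
    (Eh' : [set h' @: e | e : {set L} in edges L] = edges K) :
    cancel h h' -> cancel (power_map (m := m) Eh) (power_map (m := m) Eh').
  move=> hh' [u|[e j]] /=; first by rewrite hh'.
  congr (inr (_, _)); apply: val_inj; rewrite /= -imset_comp.
  by rewrite (eq_imset _ hh') imset_id.
exists (power_map Ef); first by exists (power_map Eg); apply: cancel_map.
have mapE e : [set power_map Ef x | x in @power_edge m G1 e] =
    @power_edge m G2 (exist _ (f @: val e) (imset_edge Ef e)).
  apply/setP => y; apply/imsetP/idP => [[[u|[e' j]] + ->]|].
  - by rewrite !inl_power_edge /= => ue; rewrite imset_f.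
  - by rewrite !inr_power_edge => /eqP ->.
  case: y => [u|[e' j]].
    rewrite inl_power_edge => /imsetP[v ve ->]; exists (inl v) => //.
    by rewrite inl_power_edge.
  by rewrite inr_power_edge => /eqP ->; exists (inr (e, j)); rewrite ?inr_power_edge.
apply/setP => h; apply/imsetP/imsetP => [[_ /imsetP[e _ ->] ->]|[e _ ->]].
  by exists (exist _ (f @: val e) (imset_edge Ef e)).
have e1 : g @: val e \in edges G1 by rewrite -Eg imset_f // (valP e).
pose e' : {e : {set G1} | e \in edges G1} := exist _ (g @: val e) e1.
exists (@power_edge m G1 e'); first exact: imset_f.
rewrite mapE; congr power_edge; apply: val_inj => /=.
by rewrite -imset_comp (eq_imset _ gf) imset_id.
Qed.

(* The vertices of L are pendant at a, all remaining ones at c.  This is the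
   graph underlying BC for L = set0, and star_shape for L = [set w]. *)
Definition spider_shape (T : finType) (E : {set {set T}}) c a b d f (L : {set T}) :=
  [/\ uniq [:: c; a; b; d; f], (forall v, v \in L -> v \notin [:: c; a; b; d; f]) &
    E = [set [set v; if v \in L then a else c] | v in [set~ c]] :|:
          [set [set a; b]; [set d; f]]].

(** Both lists are completed to enumerations of their types, and h matches equal positions. *)
Lemma bijection_extending (T T' : finType) (s : seq T) (s' : seq T') :
  uniq s -> uniq s' -> size s = size s' -> #|T| = #|T'| -> 0 < size s ->
  exists h : T -> T', bijective h /\
    forall x0 x0' i, i < size s -> h (nth x0 s i) = nth x0' s' i.
Proof.
move=> us us' ss cT; case: s' => [|y0 t'] in us' ss *; first by rewrite ss.
set s' := y0 :: t' in us' ss * => s0.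
pose ext (U : finType) (r : seq U) := r ++ [seq x <- enum U | x \notin r].
have uext (U : finType) (r : seq U) : uniq r -> uniq (ext U r).
  move=> ur; rewrite cat_uniq ur filter_uniq ?enum_uniq // andbT /=.
  by apply/hasPn => x; rewrite mem_filter => /andP[].
have mext (U : finType) (r : seq U) x : x \in ext U r.
  by rewrite mem_cat mem_filter mem_enum andbT; case: (x \in r).
have sext (U : finType) (r : seq U) : uniq r -> size (ext U r) = #|U|.
  move=> ur; rewrite cardT; apply/perm_size/uniq_perm; rewrite ?uext ?enum_uniq //.
  by move=> x; rewrite mext mem_enum.
pose h x := nth y0 (ext T' s') (index x (ext T s)).
have ltx x : index x (ext T s) < size (ext T' s').
  by rewrite sext // -cT -(sext _ _ us) index_mem mext.
exists h; split.
  apply: inj_card_bij; last by rewrite cT.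
  move=> x y /eqP; rewrite nth_uniq ?uext // => /eqP xy.
  by rewrite -(nth_index x (mext _ s x)) xy nth_index // mext.
move=> x0 x0' i is_; rewrite /h.
have -> : nth x0 s i = nth x0 (ext T s) i by rewrite nth_cat is_.
rewrite index_uniq ?uext //; last by rewrite size_cat ltn_addr.
by rewrite nth_cat -ss is_; apply: set_nth_default; rewrite -ss.
Qed.

(** The shape fixes every edge once the five named vertices and L are known, so any bijection that
    respects these is an isomorphism. *)
Lemma spider_shape_iso (G1 G2 : hypergraph) c1 a1 b1 d1 f1 L1 c2 a2 b2 d2 f2 L2 :
  spider_shape (edges G1) c1 a1 b1 d1 f1 L1 ->
  spider_shape (edges G2) c2 a2 b2 d2 f2 L2 ->
  #|L1| = #|L2| -> #|G1| = #|G2| -> hg_iso G1 G2.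
Proof.
move=> [u1 n1 E1] [u2 n2 E2] cL cG.
have ul (T : finType) (s : seq T) (L : {set T}) : uniq s ->
    (forall v, v \in L -> v \notin s) -> uniq (s ++ enum L).
  move=> us nL; rewrite cat_uniq us enum_uniq andbT /=.
  by apply/hasPn => x; rewrite mem_enum => /nL.
have ss : size ([:: c1; a1; b1; d1; f1] ++ enum L1) =
    size ([:: c2; a2; b2; d2; f2] ++ enum L2).
  by rewrite !size_cat -!cardE cL.
have [//|h [bh hE]] :=
  bijection_extending (ul _ _ _ u1 n1) (ul _ _ _ u2 n2) ss cG.
have h_inj := bij_inj bh.
have hc : h c1 = c2 by apply: (hE c1 c2 0).
have ha : h a1 = a2 by apply: (hE c1 c2 1).
have hb : h b1 = b2 by apply: (hE c1 c2 2).
have hd : h d1 = d2 by apply: (hE c1 c2 3).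
have hf : h f1 = f2 by apply: (hE c1 c2 4).
have hL : h @: L1 = L2.
  apply/eqP; rewrite eqEcard card_imset // cL leqnn andbT.
  apply/subsetP => _ /imsetP[v vL ->].
  have iL : index v (enum L1) < size (enum L1) by rewrite index_mem mem_enum.
  have := hE c1 c2 (5 + index v (enum L1)); rewrite size_cat ltn_add2l => /(_ iL).
  rewrite !nth_cat /= !addKn nth_index ?mem_enum // => ->.
  by rewrite -mem_enum mem_nth // -cardE -cL cardE.
have mL v : (h v \in L2) = (v \in L1) by rewrite -hL mem_imset.
have hset2 u v : h @: [set u; v] = [set h u; h v] by rewrite imsetU !imset_set1.
exists h => //; rewrite E1 E2 imsetU imsetU !imset_set1 !hset2 ha hb hd hf.
congr (_ :|: _); rewrite -imset_comp; apply/setP => e.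
apply/imsetP/imsetP => [[v + ->]|[u + ->]]; rewrite !inE => nc.
  exists (h v); first by rewrite !inE -hc (inj_eq h_inj).
  by rewrite /= hset2 mL; case: ifP; rewrite ?ha ?hc.
have [h' _ hh'] := bh; rewrite -(hh' u) -hc (inj_eq h_inj) in nc *.
exists (h' u); first by rewrite !inE.
by rewrite /= hset2 mL; case: ifP; rewrite ?ha ?hc.
Qed.

(** * The graph underlying B2C *)

Section B2CShape.
Variables l1 l2 : nat.

Let V := ('I_3 + 'I_2 + 'I_l1 + 'I_l2)%type.
Let I := ('I_3 + 'I_3 + 'I_l1 + 'I_l2)%type.
Let b2c_edge : I -> {set V} :=
  attach_graph_edge (attach_graph_edge triangles_graph_edge (inl ord0))
    (inl (inl ord_max)).

Lemma b2c_edge_inj : injective b2c_edge.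
Proof. by do 2 apply: attach_graph_edge_inj; apply: triangles_graph_edge_inj. Qed.

Lemma card_b2c_edge i : #|b2c_edge i| = 2.
Proof.
case: i => [[[i|i]|k]|k] /=; rewrite ?card_imset ?cards2 //; try by move=> ? ? [].
  by rewrite eq_sym (inj_eq inl_inj) ordS3_neq.
by rewrite eq_sym (inj_eq second_core_inj) ordS3_neq.
Qed.

Lemma b2c_edges_neq0 : set0 \notin [set b2c_edge i | i : I].
Proof.
apply/imsetP => -[i _ E]; have := card_b2c_edge i.
by rewrite -E cards0.
Qed.

Definition b2c_graph : hypergraph := Hypergraph b2c_edges_neq0.

Lemma b2c_graph_uniform : uniform 2 b2c_graph.
Proof. by move=> _ /imsetP[i _ ->]; apply: card_b2c_edge. Qed.

Lemma card_b2c_graph : #|b2c_graph| = 5 + l1 + l2.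
Proof. by rewrite !card_sum !card_ord. Qed.

Lemma B2C_iso_power m : 1 < m -> hg_iso (B2C m l1 l2) (power m b2c_graph).
Proof.
move=> m1; have m1' : 0 < m - 1 by lia.
have p0 := presents_two_triangles m1.
have p1 := presents_attach l1 (inl ord0) m1' p0.
have p2 := presents_attach l2 (inl (inl ord_max)) m1' p1.
exact: (presents_power_iso m1 b2c_graph_uniform erefl b2c_edge_inj p2).
Qed.

(** Here a is core vertex 2 of the first triangle, which carries the l2 pendant edges, b is core
    vertex 1, and d, f come from the second triangle. *)
Lemma b2c_graph_shape :
  @spider_shape V [set b2c_edge i | i : I] (inl (inl (inl ord0)))
    (inl (inl (inl (lift ord0 ord_max)))) (inl (inl (inl (lift ord0 ord0))))
    (inl (inl (inr ord0))) (inl (inl (inr ord_max))) [set inr k | k : 'I_l2].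
Proof.
have I3 (i : 'I_3) : [\/ i = ord0, i = lift ord0 ord0 | i = lift ord0 ord_max].
  by case: i => [[|[|[|//]]] p]; [apply: Or31 | apply: Or32 | apply: Or33];
     apply: val_inj.
have I2 (i : 'I_2) : i = ord0 \/ i = ord_max.
  by case: i => [[|[|//]] p]; [left|right]; apply: val_inj.
have S0 : ordS (ord0 : 'I_3) = lift ord0 ord0 by apply: val_inj.
have S1 : ordS (lift ord0 ord0 : 'I_3) = lift ord0 ord_max by apply: val_inj.
have S2 : ordS (lift ord0 ord_max : 'I_3) = ord0 by apply: val_inj.
have sc0 : second_core ord0 = inl ord0 by rewrite /second_core unlift_none.
have scl j : second_core (lift ord0 j) = inr j by rewrite /second_core liftK.
have maxE : ord_max = lift ord0 ord_max :> 'I_3 by apply: val_inj.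
have nL (v : 'I_3 + 'I_2 + 'I_l1) :
    ((inl v : V) \in [set inr k | k : 'I_l2]) = false by apply/imsetP => -[].
have inl2 (X Y : finType) (x y : X) :
    [set (inl z : X + Y) | z in [set x; y]] = [set inl x; inl y].
  by rewrite imsetU !imset_set1.
split.
- by [].
- by move=> _ /imsetP[k _ ->]; rewrite !inE.
- apply/setP => e; rewrite inE; apply/imsetP/orP => [[i _ ->]|].
    case: i => [[[i|i]|k]|k] /=; rewrite ?inl2.
    + case: (I3 i) => ->; rewrite ?S0 ?S1 ?S2.
      * left; apply/imsetP; exists (inl (inl (inl (lift ord0 ord0)))); first by rewrite !inE.
        by rewrite nL setUC.
      * by right; rewrite !inE setUC eqxx.
      * left; apply/imsetP; exists (inl (inl (inl (lift ord0 ord_max)))); first by rewrite !inE.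
        by rewrite nL.
    + case: (I3 i) => ->; rewrite ?S0 ?S1 ?S2 ?sc0 ?scl.
      * left; apply/imsetP; exists (inl (inl (inr ord0))); first by rewrite !inE.
        by rewrite nL setUC.
      * by right; rewrite !inE eqxx orbT.
      * left; apply/imsetP; exists (inl (inl (inr ord_max))); first by rewrite !inE.
        by rewrite nL.
    + left; apply/imsetP; exists (inl (inr k)); first by rewrite !inE.
      by rewrite nL setUC.
    + left; apply/imsetP; exists (inr k); first by rewrite !inE.
      by rewrite imset_f // setUC maxE.
  case=> [/imsetP[v + ->]|].
    case: v => [[[i|i]|k]|k]; rewrite !inE ?nL.
    + case: (I3 i) => -> // _.
        by exists (inl (inl (inl ord0))) => //=; rewrite S0 !inl2 setUC.
      by exists (inl (inl (inl (lift ord0 ord_max)))) => //=; rewrite S2 !inl2.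
    + case: (I2 i) => -> // _.
        exists (inl (inl (inr ord0))) => //=.
        by rewrite S0 sc0 scl !inl2 setUC.
      exists (inl (inl (inr (lift ord0 ord_max)))) => //=.
      by rewrite S2 sc0 scl !inl2.
    + by move=> _; exists (inl (inr k)) => //=; rewrite !inl2 setUC.
    + by move=> _; exists (inr k) => //=; rewrite imset_f // maxE setUC.
  rewrite !inE => /orP[]/eqP->.
    by exists (inl (inl (inl (lift ord0 ord0)))) => //=; rewrite S1 !inl2 setUC.
  exists (inl (inl (inr (lift ord0 ord0)))) => //=.
  by rewrite S1 !scl !inl2.
Qed.

End B2CShape.

Lemma star_shape_spider (T : finType) (E : {set {set T}}) c a b d f w :
  star_shape E c a b d f w -> spider_shape E c a b d f [set w].
Proof.
move=> [un EE]; split.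
- by move: un; distinct.
- by move=> v; rewrite inE => /eqP ->; move: un; distinct.
- by rewrite EE; congr (_ :|: _); apply: eq_imset => v; rewrite inE.
Qed.

Lemma spider_star_shape (T : finType) (E : {set {set T}}) c a b d f w :
  spider_shape E c a b d f [set w] -> star_shape E c a b d f w.
Proof.
move=> [un wn EE]; split.
- by have := wn w (set11 w); move: un; distinct.
- by rewrite EE; congr (_ :|: _); apply: eq_imset => v; rewrite inE.
Qed.

Lemma hg_iso_card_edges H K : hg_iso H K -> #|edges H| = #|edges K|.
Proof.
move=> [f bf <-]; rewrite card_imset //.
by apply: imset_inj; apply: bij_inj.
Qed.

Lemma hg_iso_connected H K : hg_iso H K -> connected_hg H -> connected_hg K.
Proof.
move=> [f [g fg gf] Ef] con x y; rewrite -(gf x) -(gf y).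
have /connectP[p] := con (g x) (g y).
elim: p (g x) => [|z p IH] u /=; first by move=> _ ->.
move=> /andP[/andP[nuz /existsP[e /and3P[eH ue ze]]] pz] yE.
apply: (connect_trans _ (IH z pz yE)); apply: connect1.
rewrite /adj (can_eq fg) nuz; apply/existsP; exists (f @: e).
by rewrite -Ef !imset_f.
Qed.

(** Used with l2 = 0 for the excluded hypergraph and with l2 = 1 for the extremal one. *)
Lemma spider_shape_B2C_iso m H (G : hypergraph) l1 l2 c a b d f (L : {set G}) :
  (1 < m)%N -> hg_iso H (power m G) -> spider_shape (edges G) c a b d f L ->
  #|L| = l2 -> #|G| = (5 + l1 + l2)%N -> hg_iso H (B2C m l1 l2).
Proof.
move=> m1 HG sh cL cG.
apply: (hg_iso_trans HG); apply: (hg_iso_trans _ (hg_iso_sym (B2C_iso_power l1 l2 m1))).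
apply: power_iso; apply: (spider_shape_iso (G2 := b2c_graph l1 l2) sh (b2c_graph_shape l1 l2)).
  by rewrite cL card_imset ?card_ord // => ? ? [].
by rewrite cG card_b2c_graph.
Qed.

Local Open Scope ring_scope.

(** * Edge shifting *)

Lemma sumr_le_eq (R : numDomainType) (I : finType) (P : pred I) (F G : I -> R) :
  (forall i, P i -> F i <= G i) -> \sum_(i | P i) F i = \sum_(i | P i) G i ->
  forall i, P i -> F i = G i.
Proof.
move=> FG E i Pi; apply/eqP; rewrite eq_sym -subr_eq0; apply/eqP.
apply: (@psumr_eq0P _ _ P (fun i => G i - F i)) => //.
  by move=> j Pj; rewrite subr_ge0 FG.
by rewrite sumrB E subrr.
Qed.

Section Energy.
Variables (R : realFieldType) (T : finType) (beta : R) (x : T -> R).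

Definition energy u v : R := 2 * x u * x v + beta * (x u ^+ 2 + x v ^+ 2).

Lemma energyC u v : energy u v = energy v u.
Proof. by rewrite /energy; ring. Qed.

Hypothesis beta0 : 0 <= beta.
Hypothesis x0 : forall v, 0 <= x v.

Lemma energy_le u v w : x u <= x v -> energy w u <= energy w v.
Proof.
move=> uv; rewrite /energy; have := x0 u; have := x0 w => w0 u0.
have sq : x u ^+ 2 <= x v ^+ 2 by rewrite ler_sqr ?nnegrE // (le_trans u0).
apply: lerD; first by rewrite -!mulrA ler_wpM2l // ler_wpM2l.
by apply: ler_wpM2l => //; rewrite lerD2l.
Qed.

Lemma energy_lt u v w : x u < x v -> 0 < x w -> energy w u < energy w v.
Proof.
move=> uv w0; rewrite /energy; have u0 := x0 u.
have sq : x u ^+ 2 <= x v ^+ 2 by rewrite ler_sqr ?nnegrE ?(le_trans u0) // ltW.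
apply: ltr_leD; first by rewrite -!mulrA ltr_pM2l // ltr_pM2l.
by apply: ler_wpM2l => //; rewrite lerD2l.
Qed.

(** The squares cancel because every vertex keeps its degree; the products obey the rearrangement
    inequality. *)
Lemma energy_swap u v u' v' : x u <= x u' -> x v <= x v' ->
  energy v' u + energy v u' <= energy v' u' + energy v u.
Proof.
move=> uu vv; rewrite -subr_ge0 /energy.
have : 0 <= (x u' - x u) * (x v' - x v) by rewrite mulr_ge0 ?subr_ge0.
by move=> ?; lra.
Qed.

(** A function of the parent map and the two extra edges rather than of an edge set, so that moving
    an edge amounts to changing an argument. *)
Definition rooted_energy (c : T) (p : T -> T) (a b d f : T) :=
  \sum_(v | v != c) energy v (p v) + energy a b + energy d f.

Lemma rooted_energy_star c w y a b d f : w != c ->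
  rooted_energy c (star c w y) a b d f =
  \sum_(v | v != c) energy v c - energy w c + energy w y + energy a b + energy d f.
Proof.
move=> wc; rewrite /rooted_energy (bigD1 w) //= /star eqxx.
rewrite [X in _ = X - _ + _ + _ + _](bigD1 w) //=.
rewrite (eq_bigr (fun v => energy v c)); last by move=> v /andP[_ /negPf ->].
by ring.
Qed.

Lemma rooted_energy_sym12 c p a b d f :
  rooted_energy c p b a d f = rooted_energy c p a b d f.
Proof. by rewrite /rooted_energy energyC. Qed.

Lemma rooted_energy_sym1234 c p a b d f :
  rooted_energy c p d f a b = rooted_energy c p a b d f.
Proof. by rewrite /rooted_energy addrAC. Qed.

(** * Moving edges towards larger values of x *)

Section Shift.
Variables (E : {set {set T}}) (c : T) (B : R).
Hypothesis xc : forall v, x v <= x c.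
(** Supplied later with B the bound for the extremal graph. The second clause records what
    proportionality to its eigenvector implies, and it is the source of all strict inequalities
    below. *)
Hypothesis star_bound : forall a b d f w, uniq [:: c; a; b; d; f; w] ->
  rooted_energy c (star c w a) a b d f <= B /\
  (rooted_energy c (star c w a) a b d f = B ->
    [/\ forall v, 0 < x v, forall v, v != c -> x v < x c &
        forall v, v \notin [:: c; a; b; d; f] -> x v < x a]).

Definition below_star p a b d f :=
  rooted_energy c p a b d f <= B /\
  (rooted_energy c p a b d f = B ->
    exists a b d f w, star_shape E c a b d f w).

Lemma below_star_sym12 p a b d f : below_star p b a d f -> below_star p a b d f.
Proof. by rewrite /below_star rooted_energy_sym12. Qed.

Lemma below_star_sym1234 p a b d f : below_star p d f a b -> below_star p a b d f.
Proof. by rewrite /below_star rooted_energy_sym1234. Qed.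

Local Notation dec := (cactus_decomposition E c).

Lemma dec_sym12 p a b d f : dec p a b d f -> dec p b a d f.
Proof.
move=> [un EE inj ne [cut con]]; split => //.
- by move: un; distinct.
- by rewrite [[set b; a]]setUC.
- by move=> v /ne; rewrite [[set b; a]]setUC.
- by split => // X v0; rewrite eq_sym; apply: cut.
Qed.

Lemma dec_sym1234 p a b d f : dec p a b d f -> dec p d f a b.
Proof.
move=> [un EE inj ne [cut con]]; split => //.
- by move: un; distinct.
- by rewrite [[set [set d; f]; _]]setUC.
- by move=> v /ne /and3P[-> -> ->].
- by split => // X v0 ? ?; apply: cut.
Qed.

Lemma energy_le_root v y : energy v y <= energy v c.
Proof. exact: energy_le. Qed.

(* x is largest at c, so that every tree edge except w (p w) may be reattached
   to c. *)
Lemma rooted_energy_le_star p a b d f w :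
  rooted_energy c p a b d f <= rooted_energy c (star c w (p w)) a b d f.
Proof.
rewrite /rooted_energy !lerD2r; apply: ler_sum => v _; rewrite /star.
by case: eqP => [->|_] //; apply: energy_le_root.
Qed.

(** For shifts that move an edge: a value B before the shift forces B after it, hence the strict
    order of the entries, under which the shift was a strict gain. So equality is excluded. *)
Lemma below_star_strict p a b d f a' b' d' f' w' :
  uniq [:: c; a'; b'; d'; f'; w'] ->
  rooted_energy c p a b d f <= rooted_energy c (star c w' a') a' b' d' f' ->
  ((forall v, 0 < x v) -> (forall v, v != c -> x v < x c) ->
    (forall v, v \notin [:: c; a'; b'; d'; f'] -> x v < x a') ->
    rooted_energy c p a b d f < rooted_energy c (star c w' a') a' b' d' f') ->
  below_star p a b d f.
Proof.
move=> un le lt; have [leB eqB] := star_bound un.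
split; first exact: le_trans leB.
move=> eB; have [x_gt0 xlt xa] : [/\ forall v, 0 < x v, forall v, v != c -> x v < x c &
    forall v, v \notin [:: c; a'; b'; d'; f'] -> x v < x a'].
  by apply/eqB/le_anti; rewrite leB -eB le.
by have := lt x_gt0 xlt xa; rewrite eB ltNge leB.
Qed.

(** The only case that admits equality, since w may stay where it is. At the value B the energies
    agree term by term, and x v < x c for v != c then shows that every other vertex already hangs at
    c. *)
Lemma below_star_pendant_at_triangle p a b d f w : dec p a b d f ->
  w \notin [:: c; a; b; d; f] -> p w = a -> below_star p a b d f.
Proof.
move=> [un EE inj ne _] wn pw.
have un' : uniq [:: c; a; b; d; f; w].
  by move: un wn; distinct.
have wc : w != c by move: wn; rewrite inE => /norP[].
have [leB eqB] := star_bound un'.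
have le := rooted_energy_le_star p a b d f w; rewrite pw in le.
split; first exact: le_trans leB.
move=> eB; have eS : rooted_energy c (star c w a) a b d f = B.
  by apply: le_anti; rewrite leB -eB le.
have [x_gt0 xlt _] := eqB eS.
exists a, b, d, f, w; split => //; rewrite EE; congr (_ :|: _).
apply: eq_in_imset => v; rewrite !inE => vc.
have ev : energy v (p v) = energy v (star c w a v).
  apply: (@sumr_le_eq _ _ (fun v => v != c) (fun v => energy v (p v))
    (fun v => energy v (star c w a v))) vc => [u _|].
    by rewrite /star; case: eqP => [->|_]; [rewrite pw | apply: energy_le_root].
  by move: eB; rewrite -eS /rooted_energy => /addIr /addIr.
rewrite /star in ev *; case: eqP => [->|/eqP vw]; first by rewrite pw.
rewrite (negPf vw) in ev; case: (eqVneq (p v) c) => [->//|pvc].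
by have := energy_lt (xlt _ pvc) (x_gt0 v); rewrite ev ltxx.
Qed.

(* Either w is moved from its neighbour y = p w to a, or, when x a < x y, the
   edge a b is replaced by y b. *)
Lemma below_star_pendant_at_leaf p a b d f w : dec p a b d f ->
  w \notin [:: c; a; b; d; f] -> p w \notin [:: c; a; b; d; f] ->
  below_star p a b d f.
Proof.
move=> [un EE inj ne _] wn pwn.
have wc : w != c by move: wn; rewrite inE => /norP[].
have wp : w != p w by have /and3P[] := ne w wc.
have le := rooted_energy_le_star p a b d f w; move: le pwn wp.
move: (p w) => y le yn wy.
have unw : uniq [:: c; a; b; d; f; w].
  by move: un wn; distinct.
case: (lerP (x y) (x a)) => xya.
  apply: (@below_star_strict _ _ _ _ _ a b d f w) => //.
    apply: (le_trans le); rewrite !rooted_energy_star //.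
    by have := energy_le w xya; lra.
  move=> x_gt0 _ xa; apply: (le_lt_trans le); rewrite !rooted_energy_star //.
  by have := energy_lt (xa y yn) (x_gt0 w); lra.
apply: (@below_star_strict _ _ _ _ _ y b d f w).
- by move: unw yn wy; distinct.
- apply: (le_trans le); rewrite !rooted_energy_star //.
  by have := energy_le b (ltW xya); rewrite !(energyC b); lra.
- move=> x_gt0 _ _; apply: (le_lt_trans le); rewrite !rooted_energy_star //.
  by have := energy_lt xya (x_gt0 b); rewrite !(energyC b); lra.
Qed.

(* The cycle c y a b is shortened: either a b becomes y b, leaving a pendant at y,
   or, when x y < x a, y c becomes a c, leaving y pendant at a. *)
Lemma below_star_long_cycle p a b d f : dec p a b d f ->
  p a != c -> p a \notin [:: d; f] -> below_star p a b d f.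
Proof.
move=> [un EE inj ne _] pac pan.
have /and3P[ac ab bc] : [&& a != c, a != b & b != c] by move: un; distinct.
have /and3P[ap pab _] := ne a ac.
have le := rooted_energy_le_star p a b d f a; move: le pac pan ap pab.
move: (p a) => y le yc yn ay yb.
have {}yb : y != b by apply: contraNneq yb => ->.
have uny : uniq [:: c; y; b; d; f; a].
  by move: un yn yc yb ay; distinct.
have una : uniq [:: c; a; b; d; f; y].
  by move: un yn yc yb ay; distinct.
case: (lerP (x a) (x y)) => xay.
  apply: (below_star_strict uny).
    apply: (le_trans le); rewrite !rooted_energy_star //.
    by have := energy_le b xay; rewrite !(energyC b); lra.
  move=> x_gt0 _ xa; apply: (le_lt_trans le); rewrite !rooted_energy_star //.
  have an : a \notin [:: c; y; b; d; f].
    by move: uny; distinct.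
  by have := energy_lt (xa a an) (x_gt0 b); rewrite !(energyC b); lra.
apply: (below_star_strict una).
  apply: (le_trans le); rewrite !rooted_energy_star //.
  by have := energy_le c (ltW xay); rewrite !(energyC c) (energyC a y); lra.
move=> x_gt0 _ _; apply: (le_lt_trans le); rewrite !rooted_energy_star //.
by have := energy_lt xay (x_gt0 c); rewrite !(energyC c) (energyC a y); lra.
Qed.

(* The triangle d a b is attached at d to the triangle c d f, and l is a leaf at c.
   The edge b d becomes b c; then either a b becomes l b, or, when x l < x a, the
   edges a d and l c become a c and l d. *)
Lemma below_star_chained_triangles p a b d f l : dec p a b d f ->
  p a = d -> p b = d -> l \notin [:: c; a; b; d; f] ->
  (forall v, v != c -> v != a -> v != b -> p v = c) -> below_star p a b d f.
Proof.
move=> [un EE inj ne _] pa pb ln pv.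
have /and4P[ac bc ba dc] : [&& a != c, b != c, b != a & d != c].
  by move: un; distinct.
have lc : l != c by move: ln; rewrite inE => /norP[].
have SE : rooted_energy c p a b d f = \sum_(v | v != c) energy v c
   - energy a c - energy b c + energy a d + energy b d + energy a b + energy d f.
  rewrite /rooted_energy (bigD1 a) //= (bigD1 b) /=; last by rewrite bc.
  rewrite [X in _ = X - _ - _ + _ + _ + _ + _](bigD1 a) //=.
  rewrite [X in _ = _ + X - _ - _ + _ + _ + _ + _](bigD1 b) /=; last by rewrite bc.
  rewrite (eq_bigr (fun v => energy v c)) => [|v /andP[/andP[vc va] vb]]; last by rewrite pv.
  by rewrite pa pb; ring.
case: (lerP (x a) (x l)) => xal.
  apply: (@below_star_strict _ _ _ _ _ d f l b a).
  - by move: un ln; distinct.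
  - rewrite SE rooted_energy_star //.
    have := energy_le b xal; have := energy_le_root b d.
    by rewrite !(energyC b a) !(energyC b l); lra.
  - move=> x_gt0 xlt _; rewrite SE rooted_energy_star //.
    have := energy_le b xal; have := energy_lt (xlt d dc) (x_gt0 b).
    by rewrite !(energyC b a) !(energyC b l); lra.
apply: (@below_star_strict _ _ _ _ _ d f a b l).
- by move: un ln; distinct.
- rewrite SE rooted_energy_star //.
  by have := energy_swap (xc d) (ltW xal); have := energy_le_root b d; lra.
- move=> x_gt0 xlt _; rewrite SE rooted_energy_star //.
  have := energy_swap (xc d) (ltW xal); have := energy_lt (xlt d dc) (x_gt0 b).
  by lra.
Qed.

(* When p a lies on the other triangle edge, the absence of cuts consisting of
   ab, df and one tree edge leaves only the chain of two triangles. *)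
Lemma below_star_shared_parent p a b d f : dec p a b d f -> (5 < #|T|)%N ->
  (forall v, v \notin [:: c; a; b; d; f] -> p v = c) ->
  p a = d -> p b \in [:: c; d; f] -> p d \in [:: c; a; b] ->
  p f \in [:: c; a; b] -> below_star p a b d f.
Proof.
move=> D cT pv pa pb pd pf; have [un EE inj ne [cut con]] := D.
have [l ln] : exists l, l \notin [:: c; a; b; d; f].
  apply/existsP; rewrite -negb_forall; apply: contraL cT => /forallP H.
  rewrite -leqNgt -[5%N]/(size [:: c; a; b; d; f]) -(card_uniqP un).
  by apply: subset_leq_card; apply/subsetP => y _; apply: H.
have nE : (((a == c = false) * (b == c = false) * (d == c = false) * (f == c = false) *
  (c == a = false) * (c == b = false) * (c == d = false) * (c == f = false)) *
  ((a == b = false) * (b == a = false) * (a == d = false) * (d == a = false) *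
   (a == f = false) * (f == a = false)) *
  ((b == d = false) * (d == b = false) * (b == f = false) * (f == b = false) *
   (d == f = false) * (f == d = false)))%type.
  move: un; rewrite /= !inE !negb_or ![_ == c]eq_sym ![_ == a]eq_sym ![_ == b]eq_sym (eq_sym f d).
  by move=> /and5P[/and4P[/negPf-> /negPf-> /negPf-> /negPf->]
    /and3P[/negPf-> /negPf-> /negPf->] /andP[/negPf-> /negPf->] /negPf-> _].
have {pd} pd : p d \in [:: c; b].
  (* p d = a is impossible, as the same tree edge would then belong to both a and d. *)
  move: pd; rewrite !inE => /or3P[->//|/eqP pd|->]; last by rewrite orbT.
  have : a = d.
    apply: inj; rewrite ?inE ?nE //= pa pd; exact: setUC.
  by move/eqP; rewrite !nE.
have other (X : {set T}) (v : T) : X \subset [:: a; b; d; f] -> v != c ->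
    v != a -> v != b -> v != d -> v != f -> (v \in X) = (p v \in X).
  move=> sX vc va vb vd vf.
  have nv y : y \notin [:: a; b; d; f] -> (y \in X) = false.
    by move=> yn; apply: contraNF yn; apply: (subsetP sX).
  rewrite pv ?nv //; rewrite !inE ?nE // !negb_or ?vc ?va ?vb ?vd ?vf //.
pose closed_but (X : {set T}) v0 := forall v, v != c -> v != v0 -> (v \in X) = (p v \in X).
(* Vertices other than a, b, d, f hang at c, outside X, so only the tree edges of these four
   vertices can cross X. *)
have closeP (X : {set T}) v0 : X \subset [:: a; b; d; f] ->
    [|| a == v0 | (a \in X) == (d \in X)] ->
    [|| b == v0 | (b \in X) == (p b \in X)] ->
    [|| d == v0 | (d \in X) == (p d \in X)] ->
    [|| f == v0 | (f \in X) == (p f \in X)] -> closed_but X v0.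
  move=> sX aX bX dX fX v vc; rewrite eq_sym => vv0.
  case: (eqVneq v a) => [va|va].
    by move: aX; rewrite va pa -va eq_sym (negPf vv0) => /eqP.
  case: (eqVneq v b) => [vb|vb].
    by move: bX; rewrite vb -{1}vb eq_sym (negPf vv0) => /eqP.
  case: (eqVneq v d) => [vd|vd].
    by move: dX; rewrite vd -{1}vd eq_sym (negPf vv0) => /eqP.
  case: (eqVneq v f) => [vf|vf].
    by move: fX; rewrite vf -{1}vf eq_sym (negPf vv0) => /eqP.
  exact: other.
have nsame u v : u != c -> v != c -> p u = v -> p v = u -> u = v.
  by move=> uc vc uv vu; apply: inj; rewrite ?inE //= uv vu setUC.
have sub2 u v : u \in [:: a; b; d; f] -> v \in [:: a; b; d; f] ->
  [set u; v] \subset [:: a; b; d; f].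
  by move=> ui vi; apply/subsetP => w; rewrite !in_set2 => /orP[]/eqP->.
(* The unwanted values of p are excluded by the sets {a, f}, {b, f} and {a, d}: each separates a
   from b and d from f and is crossed by the single tree edge of the vertex v0 passed to [cut]. *)
have [pfa|pfa] := eqVneq (p f) a.
  case: (eqVneq (p b) f) => [pbf|pbf]; last first.
    exfalso; apply: (cut [set a; f] a); rewrite ?inE ?nE ?eqxx //.
    apply: closeP; rewrite ?sub2 ?inE ?pfa ?nE ?eqxx ?orbT //.
      by move: pb; rewrite !inE (negPf pbf) orbF => /orP[]/eqP->; rewrite !nE.
    by move: pd; rewrite !inE => /orP[]/eqP->; rewrite !nE.
  move: pd; rewrite !inE => /orP[]/eqP pd.
    exfalso; apply: (cut [set b; f] f); rewrite ?inE ?nE ?eqxx //.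
    by apply: closeP; rewrite ?sub2 ?inE ?pfa ?pbf ?pd ?nE ?eqxx ?orbT.
  (* Here p runs round a, d, b, f and back to a, so c is never reached. *)
  have : c \in [set v in [:: a; b; d; f]].
    apply: (con _ a); last by rewrite !inE eqxx.
    move=> v vc.
    have [|] := boolP (v \in [:: a; b; d; f]); last first.
      by move=> vn; rewrite pv ?inE ?nE //; move: vn; rewrite !inE ?nE => /negPf->; rewrite ?(negPf vc).
    by rewrite !inE => /or4P[]/eqP->; rewrite ?pa ?pbf ?pd ?pfa ?eqxx ?orbT.
  by rewrite !inE !nE.
have {}pf : p f \in [:: c; b] by move: pf; rewrite !inE (negPf pfa).
case: (eqVneq (p b) d) => [pbd|pbd]; last first.
  exfalso; apply: (cut [set a; d] d); rewrite ?inE ?nE ?eqxx //.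
  apply: closeP; rewrite ?sub2 ?inE ?nE ?eqxx ?orbT //.
    by move: pb; rewrite !inE (negPf pbd) => /orP[]/eqP->; rewrite !nE.
  by move: pf; rewrite !inE => /orP[]/eqP->; rewrite !nE.
have {}pd : p d = c.
  move: pd; rewrite !inE => /orP[]/eqP // pdb.
  by have := nsame b d; rewrite !nE => /(_ isT isT pbd pdb)/eqP; rewrite nE.
move: pf; rewrite !inE => /orP[]/eqP pf; last first.
  exfalso; apply: (cut [set b; f] b); rewrite ?inE ?nE ?eqxx //.
  by apply: closeP; rewrite ?sub2 ?inE ?pf ?pbd ?pd ?nE ?eqxx ?orbT.
apply: (below_star_chained_triangles D pa pbd ln) => v vc va vb.
have [->//|vd] := eqVneq v d; have [->//|vf] := eqVneq v f.
by apply: pv; rewrite !inE !negb_or vc va vb vd.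
Qed.

(** If a vertex outside c, a, b, d, f does not hang at c, a pendant lemma applies, up to the
    symmetries of the two edges. Otherwise w is an end of one of these edges, and p w either misses
    the other edge, which gives a long cycle, or is one of its ends. *)
Theorem rooted_energy_max p a b d f w : dec p a b d f -> (5 < #|T|)%N ->
  w != c -> p w != c -> below_star p a b d f.
Proof.
move=> D cT wc pwc.
have out u v q s g h : dec q u v g h -> s \notin [:: c; u; v; g; h] ->
    q s \in [:: u; v; g; h] -> below_star q u v g h.
  move=> Dq sn; rewrite !inE => /or4P[]/eqP qs.
  - exact: (below_star_pendant_at_triangle Dq sn qs).
  - apply/below_star_sym12/(below_star_pendant_at_triangle (dec_sym12 Dq) _ qs).
    by move: sn; distinct.
  - apply/below_star_sym1234/(below_star_pendant_at_triangle (dec_sym1234 Dq) _ qs).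
    by move: sn; distinct.
  - apply/below_star_sym1234/below_star_sym12.
    apply: (below_star_pendant_at_triangle (dec_sym12 (dec_sym1234 Dq)) _ qs).
    by move: sn; distinct.
have [/existsP[s /andP[sn psc]]|none] :=
    boolP [exists s, (s \notin [:: c; a; b; d; f]) && (p s != c)].
  have [pn|] := boolP (p s \notin [:: c; a; b; d; f]).
    exact: (below_star_pendant_at_leaf D sn pn).
  by rewrite negbK inE (negPf psc); apply: out.
have pv v : v \notin [:: c; a; b; d; f] -> p v = c.
  by move: none; rewrite negb_exists => /forallP/(_ v); rewrite negb_and => /orP[/negPf->|/negPn/eqP].
clear out none.
(* Now p w <> c forces w to be one of a, b, d, f. *)
have step u v g h : dec p u v g h -> perm_eq [:: a; b; d; f] [:: u; v; g; h] ->
    p u != c -> below_star p u v g h.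
  move=> Dq prm puc.
  have memE y : (y \in [:: c; u; v; g; h]) = (y \in [:: c; a; b; d; f]).
    by rewrite in_cons -(perm_mem prm) -in_cons.
  have pv' y : y \notin [:: c; u; v; g; h] -> p y = c by rewrite memE; apply: pv.
  have [pug|pun] := boolP (p u \in [:: g; h]); last exact: (below_star_long_cycle Dq).
  (* Any end of the two edges whose parent is neither c nor on the other edge settles the claim by
     the long cycle; otherwise all four parents satisfy the assumptions of
     [below_star_shared_parent]. *)
  have long y z : forall k l, dec p y z k l -> below_star p y z k l \/ p y \in [:: c; k; l].
    move=> k l Dy; have [pyc|pyc] := eqVneq (p y) c; first by right; rewrite pyc mem_head.
    have [pyk|pyk] := boolP (p y \in [:: k; l]); last by left; apply: below_star_long_cycle.
    by right; rewrite in_cons pyk orbT.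
  have [//|pu] := long _ _ _ _ Dq.
  have [/below_star_sym12//|pv1] := long _ _ _ _ (dec_sym12 Dq).
  have [/below_star_sym1234//|pg] := long _ _ _ _ (dec_sym1234 Dq).
  have [/below_star_sym12/below_star_sym1234//|ph] := long _ _ _ _ (dec_sym12 (dec_sym1234 Dq)).
  move: pug; rewrite !inE => /orP[]/eqP pug.
    exact: (below_star_shared_parent Dq).
  apply/below_star_sym1234/below_star_sym12/below_star_sym1234.
  apply: (below_star_shared_parent (dec_sym1234 (dec_sym12 (dec_sym1234 Dq)))) => //.
    by move=> y yn; apply: pv'; move: yn; distinct.
  by move: pv1; rewrite !inE => /or3P[]->; rewrite ?orbT.
have [win|] := boolP (w \in [:: a; b; d; f]); last first.
  by move=> wn; rewrite pv ?eqxx // in_cons negb_or wc in pwc *.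
move: win; rewrite !inE => /or4P[]/eqP wE; rewrite {}wE in pwc.
- exact: step D _ pwc.
- apply/below_star_sym12/(step _ _ _ _ (dec_sym12 D)) => //.
  by apply/permP => q /=; lia.
- apply/below_star_sym1234/(step _ _ _ _ (dec_sym1234 D)) => //.
  by apply/permP => q /=; lia.
- apply/below_star_sym1234/below_star_sym12/(step _ _ _ _ (dec_sym12 (dec_sym1234 D))) => //.
  by apply/permP => q /=; lia.
Qed.

End Shift.
End Energy.

(** * The Perron vector of the extremal graph *)

(* The positive eigenvector of a star shape with N pendant vertices at the
   centre c: it is 1 at c, l at these vertices, r on the triangle c d f, and
   a, b, w at the vertices so named. *)
Record star_eigenvector (R : realFieldType) (N : nat) (beta t l r a b w : R) := {
  eigen_leaf : t * l = 1;
  eigen_r : (t + beta) * r = 1 + r + 2 * beta * r;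
  eigen_a : (t + beta) * a = 1 + b + w + 3 * beta * a;
  eigen_b : (t + beta) * b = 1 + a + 2 * beta * b;
  eigen_w : (t + beta) * w = a + beta * w;
  eigen_c : t + beta = N%:R * l + 2 * r + a + b + beta * (N%:R + 4);
  eigen_t_gt0 : 0 < t;
  eigen_l_bounds : 0 < l < 1;
  eigen_r_bounds : 0 < r < 1;
  eigen_a_bounds : l < a < 1;
  eigen_b_bounds : 0 < b < 1;
  eigen_w_bounds : 0 < w < a }.

Lemma big_split_seq (R : nmodType) (T : finType) (s : seq T) (F : T -> R) :
  uniq s -> \sum_v F v = \sum_(v <- s) F v + \sum_(v | v \notin s) F v.
Proof. by move=> us; rewrite (bigID (mem s)) /= big_uniq. Qed.

(** * A sum of squares for the extremal graph *)

Section StarBound.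
Variables (R : realFieldType) (T : finType) (beta t l r ya yb yw : R) (N : nat).
Variables (x : T -> R) (c a b d f w : T).
Hypothesis eig : star_eigenvector N beta t l r ya yb yw.
Hypothesis un : uniq [:: c; a; b; d; f; w].
Hypothesis cardT : #|T| = (N + 6)%N.

Local Notation S := (rooted_energy beta x c (star c w a) a b d f).

(** With y the positive eigenvector, this is the sum over edges u v of y_u y_v (x_u / y_u - x_v /
    y_v)^2. For a leaf at c, where y is l and t l = 1, the summand becomes t (x_v - l x_c)^2. *)
Definition star_defect : R :=
  \sum_(v | v \notin [:: c; a; b; d; f; w]) t * (x v - l * x c) ^+ 2 +
  (ya * (x a / ya - x c) ^+ 2 + yb * (x b / yb - x c) ^+ 2 +
   r * (x d / r - x c) ^+ 2 + r * (x f / r - x c) ^+ 2 +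
   ya * yb * (x a / ya - x b / yb) ^+ 2 + r * r * (x d / r - x f / r) ^+ 2 +
   ya * yw * (x w / yw - x a / ya) ^+ 2).

Lemma star_defectE : (t + beta) * \sum_v x v ^+ 2 - S = star_defect.
Proof.
have [El Er Ea Eb Ew Ec t0 /andP[l0 _] /andP[r0 _] /andP[al _] /andP[b0 _]
  /andP[w0 _]] := eig.
have a0 : 0 < ya by apply: lt_trans al.
rewrite /star_defect.
have cardL : #|[predC [:: c; a; b; d; f; w]]| = N.
  apply: (@addnI 6); rewrite [RHS]addnC -cardT -(cardC (mem [:: c; a; b; d; f; w])).
  by rewrite (card_uniqP un).
have -> : \sum_(v | v \notin [:: c; a; b; d; f; w]) t * (x v - l * x c) ^+ 2 =
   (t + beta) * \sum_(v | v \notin [:: c; a; b; d; f; w]) x v ^+ 2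
   - \sum_(v | v \notin [:: c; a; b; d; f; w]) energy beta x v c
   + N%:R * (l + beta) * x c ^+ 2.
  have -> : N%:R * (l + beta) * x c ^+ 2 =
      \sum_(v | v \notin [:: c; a; b; d; f; w]) (l + beta) * x c ^+ 2.
    by rewrite sumr_const -mulrA mulr_natl; congr (_ *+ _); rewrite -cardL; apply: eq_card.
  rewrite mulr_sumr -sumrB -big_split /=; apply: eq_bigr => v _.
  have -> : t * (x v - l * x c) ^+ 2 =
    t * x v ^+ 2 - 2 * (t * l) * x v * x c + (t * l) * l * x c ^+ 2 by ring.
  by rewrite El /energy; ring.
have SE : S = \sum_(v | v \notin [:: c; a; b; d; f; w]) energy beta x v c +
   (energy beta x a c + energy beta x b c + energy beta x d c +
    energy beta x f c + energy beta x w a) + energy beta x a b + energy beta x d f.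
  have un5 : uniq [:: a; b; d; f; w] by move: un; distinct.
  rewrite /rooted_energy big_mkcond (big_split_seq _ un) /=.
  rewrite !big_cons big_nil eqxx /= add0r addr0.
  have nE : [&& a != c, b != c, d != c, f != c, w != c, a != w, b != w, d != w & f != w].
    by move: un; distinct.
  case/and5P: nE => -> -> -> -> /and5P[-> aw bw dw fw].
  rewrite /star (negPf aw) (negPf bw) (negPf dw) (negPf fw) eqxx.
  set S1 := \sum_(i | _) _.
  have -> : S1 = \sum_(v | v \notin [:: c; a; b; d; f; w]) energy beta x v c.
    apply: eq_bigr => v; rewrite !inE !negb_or => /andP[-> ].
    by move=> /and5P[_ _ _ _ /negPf ->].
  by ring.
rewrite SE (big_split_seq _ un) /= !big_cons big_nil.
move: (\sum_(v | _) x v ^+ 2) (\sum_(v | _) energy beta x v c) => S1 S2.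
have [za Xa] : exists z, x a = ya * z by exists (x a / ya); rewrite mulrC divfK // gt_eqF.
have [zb Xb] : exists z, x b = yb * z by exists (x b / yb); rewrite mulrC divfK // gt_eqF.
have [zd Xd] : exists z, x d = r * z by exists (x d / r); rewrite mulrC divfK // gt_eqF.
have [zf Xf] : exists z, x f = r * z by exists (x f / r); rewrite mulrC divfK // gt_eqF.
have [zw Xw] : exists z, x w = yw * z by exists (x w / yw); rewrite mulrC divfK // gt_eqF.
rewrite /energy Xa Xb Xd Xf Xw.
rewrite ![ya * _ / _]mulrAC ![yb * _ / _]mulrAC ![r * _ / _]mulrAC ![yw * _ / _]mulrAC.
rewrite !divff ?gt_eqF // !mul1r; move: (x c) => xc.
apply/eqP; rewrite -subr_eq0; apply/eqP.
have Ea' : (t + beta) * ya - (1 + yb + yw + 3 * beta * ya) = 0 by rewrite Ea subrr.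
have Eb' : (t + beta) * yb - (1 + ya + 2 * beta * yb) = 0 by rewrite Eb subrr.
have Er' : (t + beta) * r - (1 + r + 2 * beta * r) = 0 by rewrite Er subrr.
have Ew' : (t + beta) * yw - (ya + beta * yw) = 0 by rewrite Ew subrr.
have Ec' : t + beta - (N%:R * l + 2 * r + ya + yb + beta * (N%:R + 4)) = 0.
  by rewrite {1}Ec subrr.
(* Each term is the residual of the eigenvector equation at a vertex, times the square of x there
   over the entry there; at c the entry is 1. *)
transitivity (((t + beta) * ya - (1 + yb + yw + 3 * beta * ya)) * ya * za ^+ 2
  + ((t + beta) * yb - (1 + ya + 2 * beta * yb)) * yb * zb ^+ 2
  + ((t + beta) * r - (1 + r + 2 * beta * r)) * r * (zd ^+ 2 + zf ^+ 2)
  + ((t + beta) * yw - (ya + beta * yw)) * yw * zw ^+ 2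
  + (t + beta - (N%:R * l + 2 * r + ya + yb + beta * (N%:R + 4))) * xc ^+ 2).
  by move: (N%:R : R) => n; ring.
by rewrite Ea' Eb' Er' Ew' Ec' !mul0r !addr0.
Qed.

Lemma star_energy_le : S <= (t + beta) * \sum_v x v ^+ 2.
Proof.
rewrite -subr_ge0 star_defectE.
have [El Er Ea Eb Ew Ec t0 /andP[l0 _] /andP[r0 _] /andP[al _] /andP[b0 _]
  /andP[w0 _]] := eig.
have a0 : 0 < ya by apply: lt_trans al.
rewrite /star_defect addr_ge0 ?sumr_ge0 // => [v _|].
  by rewrite mulr_ge0 ?sqr_ge0 // ltW.
by rewrite !addr_ge0 // mulr_ge0 ?sqr_ge0 ?mulr_ge0 // ltW.
Qed.

Definition star_vector v : R :=
  if v == c then 1 else if v == a then ya else if v == b then yb else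
  if (v == d) || (v == f) then r else if v == w then yw else l.

Lemma star_energy_eq : S = (t + beta) * \sum_v x v ^+ 2 ->
  forall v, x v = x c * star_vector v.
Proof.
move=> SE.
have [El Er Ea Eb Ew Ec t0 /andP[l0 _] /andP[r0 _] /andP[al _] /andP[b0 _]
  /andP[w0 _]] := eig.
have a0 : 0 < ya by apply: lt_trans al.
have := star_defectE; rewrite SE subrr => /esym /eqP.
have sq_ge0 (u v : R) : 0 < u -> 0 <= u * v ^+ 2.
  by move=> u0; rewrite mulr_ge0 ?sqr_ge0 // ltW.
have sq_eq0 (u v : R) : 0 < u -> (u * v ^+ 2 == 0) = (v == 0).
  by move=> u0; rewrite mulf_eq0 gt_eqF //= sqrf_eq0.
rewrite /star_defect paddr_eq0; last 2 first.
- by rewrite sumr_ge0 // => v _; apply: sq_ge0.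
- by rewrite !addr_ge0 // sq_ge0 ?mulr_gt0.
rewrite !paddr_eq0 ?addr_ge0 ?sq_ge0 ?mulr_gt0 // !sq_eq0 ?mulr_gt0 // !subr_eq0.
have eqz (u y : R) : 0 < y -> u / y == x c -> u = x c * y.
  by move=> y0 /eqP <-; rewrite divfK // gt_eqF.
move=> /andP[/eqP L0 /andP[/andP[/andP[/andP[/andP[/andP[za zb] zd] zf] _] _] zw]].
have {}zw : x w = x c * yw by apply: eqz => //; rewrite (eqP zw).
move/(eqz _ _ a0): za => za; move/(eqz _ _ b0): zb => zb.
move/(eqz _ _ r0): zd => zd; move/(eqz _ _ r0): zf => zf.
move=> v; rewrite /star_vector.
have [->|vc] := eqVneq v c; first by rewrite mulr1.
have [->//|va] := eqVneq v a; have [->//|vb] := eqVneq v b.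
have [->//|vd] := eqVneq v d; have [->//|vf] := eqVneq v f => /=.
have [->//|vw] := eqVneq v w.
have vn : v \notin [:: c; a; b; d; f; w] by rewrite !inE !negb_or vc va vb vd vf vw.
have := psumr_eq0P (fun u _ => sq_ge0 t (x u - l * x c) t0) L0 vn.
by move/eqP; rewrite sq_eq0 // subr_eq0 mulrC => /eqP.
Qed.

Lemma star_energy_eq_order : 0 < x c -> S = (t + beta) * \sum_v x v ^+ 2 ->
  [/\ forall v, 0 < x v, forall v, v != c -> x v < x c &
      forall v, v \notin [:: c; a; b; d; f] -> x v < x a].
Proof.
move=> xc /star_energy_eq xE.
have [El Er Ea Eb Ew Ec t0 /andP[l0 l1] /andP[r0 r1] /andP[al a1] /andP[b0 b1]
  /andP[w0 wa]] := eig.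
have a0 : 0 < ya by apply: lt_trans al.
have w1 : yw < 1 by apply: lt_trans a1.
split.
- move=> v; rewrite xE mulr_gt0 // /star_vector.
  by do ! (case: ifP => // _).
- move=> v vc; rewrite xE -[X in _ < X]mulr1 ltr_pM2l // /star_vector (negPf vc).
  by do ! (case: ifP => // _).
- move=> v; rewrite !inE !negb_or => /and5P[vc va vb vd vf].
  have ac : a != c by move: un; distinct.
  rewrite (xE v) (xE a) ltr_pM2l // /star_vector (negPf vc) (negPf va) (negPf vb) (negPf vd).
  by rewrite (negPf vf) (negPf ac) eqxx; case: ifP.
Qed.

End StarBound.

(** * Solving the eigenvector equations *)

Section Secular.
(** In this section m stands for the uniformity minus 1 and n for the number N of pendant vertices
    at the centre; with q = m - 1, [beta_of t] is then q / (t + q + 1). *)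
Variables (R : rcfType) (m n : R).
(* The entries of the eigenvector are determined by t, except for the equation
   at the centre, which becomes secular t = 0. *)
Definition beta_of (t : R) := (m - 1) / (t + m).
Definition r_of t := 1 / (t - 1 - beta_of t).
Definition A_of t := t - beta_of t.
Definition B_of t := t - 2 * beta_of t - 1 / t.
Definition a_of t := (A_of t + 1) / (A_of t * B_of t - 1).
Definition b_of t := (B_of t + 1) / (A_of t * B_of t - 1).
Definition secular t :=
  n / t + 2 * r_of t + a_of t + b_of t + beta_of t * (n + 3) - t.

Implicit Types t : R.

Lemma beta_bounds t : 1 <= m -> 4 <= t -> 0 <= beta_of t < 1.
Proof.
move=> m1 t4; have tm : 0 < t + m by lra.
by rewrite /beta_of ltr_pdivrMr // mul1r divr_ge0 /=; lra.
Qed.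

Lemma inv_bounds t : 4 <= t -> 0 < 1 / t <= 1 / 4.
Proof.
move=> t4.
rewrite divr_gt0 //=; last by lra.
by rewrite ler_pdivrMr; lra.
Qed.

Lemma AB_bounds t : 1 <= m -> 4 <= t ->
  [/\ 3 < A_of t, 7 / 4 < B_of t & B_of t <= t].
Proof.
move=> m1 t4; have /andP[b0 b1] := beta_bounds m1 t4; have /andP[i0 i1] := inv_bounds t4.
by rewrite /A_of /B_of; split; lra.
Qed.

(** This is what t >= 4 is for. For instance a < 1 amounts to A (B - 1) > 2, and A > 3 with B > 7 /
    4 gives more than 9 / 4. *)
Lemma entries_bounds t : 1 <= m -> 4 <= t ->
  [/\ 0 < r_of t < 1, 1 / t < a_of t < 1 & 0 < b_of t < 1].
Proof.
move=> m1 t4; have /andP[b0 b1] := beta_bounds m1 t4; have /andP[i0 i1] := inv_bounds t4.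
have [A3 B1 Bt] := AB_bounds m1 t4.
have D0 : 0 < A_of t * B_of t - 1 by nra.
split.
- have U : 1 < t - 1 - beta_of t by lra.
  by rewrite /r_of divr_gt0 ?ltr_pdivrMr //=; lra.
- rewrite /a_of ltr_pdivlMr // ltr_pdivrMr // -[X in _ && X]/(_ < _).
  apply/andP; split; last by nra.
  rewrite mul1r -[X in X < _]mulrC ltr_pdivrMr; last by lra.
  by nra.
- by rewrite /b_of divr_gt0 ?ltr_pdivrMr //=; nra.
Qed.

Lemma eigenvector_of_secular t N : 1 <= m -> 4 <= t -> n = N%:R -> secular t = 0 ->
  star_eigenvector N (beta_of t) t (1 / t) (r_of t) (a_of t) (b_of t) (a_of t / t).
Proof.
move=> m1 t4 nE s0.
have /andP[b0 b1] := beta_bounds m1 t4; have /andP[i0 i1] := inv_bounds t4.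
have [A3 B1 Bt] := AB_bounds m1 t4.
have D0 : A_of t * B_of t - 1 != 0 by rewrite gt_eqF //; nra.
have U0 : t - 1 - beta_of t != 0 by rewrite gt_eqF //; lra.
have t0 : t != 0 by rewrite gt_eqF //; lra.
have [rb ab bb] := entries_bounds m1 t4.
have [/andP[_ a1] /andP[a0 _]] := (ab, ab).
have a_gt0 : 0 < a_of t by apply: lt_trans a0.
have aE : B_of t * a_of t = 1 + b_of t by rewrite /a_of /b_of; field.
have bE : A_of t * b_of t = 1 + a_of t by rewrite /a_of /b_of; field.
split => //.
- by field.
- have : (t - 1 - beta_of t) * r_of t = 1 by rewrite /r_of; field.
  by move=> H; lra.
- have -> : a_of t / t = a_of t * (1 / t) by field.
  by move: aE; rewrite /B_of => H; lra.
- by move: bE; rewrite /A_of => H; lra.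
- by field.
- have -> : N%:R * (1 / t) = n / t by rewrite -nE; field.
  by move: s0; rewrite /secular -nE => H; lra.
- by lra.
- by rewrite i0 /=; lra.
- have t_gt0 : 0 < t by lra.
  by rewrite divr_gt0 //= ltr_pdivrMr //; nra.
Qed.

Definition den_L t := t + m.
Definition den_U t := (t - 1) * (t + m) - (m - 1).
Definition den_W t :=
  (t * (t + m) - (m - 1)) * (t ^+ 2 * (t + m) - 2 * (m - 1) * t - (t + m))
  - t * (t + m) ^+ 2.

Lemma den_gt0 t : 1 <= m -> 4 <= t ->
  0 < t * den_L t * den_U t * den_W t.
Proof.
move=> m1 t4; have /andP[b0 b1] := beta_bounds m1 t4; have [A3 B1 Bt] := AB_bounds m1 t4.
have tm : 0 < t + m by lra.
have t0 : 0 < t by lra.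
have tn : t != 0 by rewrite gt_eqF.
have tmn : t + m != 0 by rewrite gt_eqF.
have UE : den_U t = (t - 1 - beta_of t) * (t + m) by rewrite /den_U /beta_of; field.
have WE : den_W t = (A_of t * B_of t - 1) * (t * (t + m) ^+ 2).
  by rewrite /den_W /A_of /B_of /beta_of; field; rewrite tn tmn.
rewrite UE WE /den_L !mulr_gt0 ?exprn_gt0 //; first by lra.
by nra.
Qed.

(** [secular] cleared of its denominators, which are positive for t >= 4, so that the intermediate
    value theorem for polynomials applies. *)
Definition secular_poly : {poly R} :=
  let t := 'X in let m' := m%:P in let n' := n%:P in
  let L := t + m' in
  let U := (t - 1) * (t + m') - (m' - 1) in
  let V := t ^+ 2 * (t + m') - 2%:R * (m' - 1) * t - (t + m') in
  let W := (t * (t + m') - (m' - 1)) * V - t * (t + m') ^+ 2 in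
  n' * L * U * W + 2%:R * t * L * L * W
  + (t * L - (m' - 1) + L) * t * L * (t * L * U)
  + (V + t * L) * L * (t * L * U)
  + (m' - 1) * (n' + 3%:R) * t * U * W - t * (t * L * U * W).

Lemma secular_polyE t : 1 <= m -> 4 <= t ->
  secular_poly.[t] = secular t * (t * den_L t * den_U t * den_W t).
Proof.
move=> m1 t4; have [A3 B1 Bt] := AB_bounds m1 t4.
have /andP[b0 b1] := beta_bounds m1 t4.
have tm : 0 < t + m by lra.
have t0 : 0 < t by lra.
have tn : t != 0 by rewrite gt_eqF.
have tmn : t + m != 0 by rewrite gt_eqF.
have UE : den_U t = (t - 1 - beta_of t) * (t + m) by rewrite /den_U /beta_of; field.
have WE : den_W t = (A_of t * B_of t - 1) * (t * (t + m) ^+ 2).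
  by rewrite /den_W /A_of /B_of /beta_of; field; rewrite tn tmn.
have Un : t - 1 - beta_of t != 0 by rewrite gt_eqF //; lra.
have Wn : A_of t * B_of t - 1 != 0 by rewrite gt_eqF //; nra.
have Un' : den_U t != 0 by rewrite UE mulf_neq0.
have Wn' : den_W t != 0 by rewrite WE !mulf_neq0 // expf_neq0.
have rE : r_of t = (t + m) / den_U t.
  by rewrite /r_of UE; field; rewrite Un tmn.
have aE : a_of t = (t * (t + m) - (m - 1) + (t + m)) * t * (t + m) / den_W t.
  rewrite /a_of WE; have -> : t * (t + m) - (m - 1) + (t + m) = (A_of t + 1) * (t + m).
    by rewrite /A_of /beta_of; field.
  by field; rewrite Wn tn tmn.
have bE : b_of t = (t ^+ 2 * (t + m) - 2 * (m - 1) * t - (t + m) + t * (t + m))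
    * (t + m) / den_W t.
  rewrite /b_of WE.
  have -> : t ^+ 2 * (t + m) - 2 * (m - 1) * t - (t + m) + t * (t + m) =
     (B_of t + 1) * (t * (t + m)).
    by rewrite /B_of /beta_of; field; rewrite tn tmn.
  by field; rewrite Wn tn tmn.
rewrite /secular rE aE bE /beta_of /den_L.
transitivity (n * (t + m) * den_U t * den_W t + 2%:R * t * (t + m) * (t + m) * den_W t
  + (t * (t + m) - (m - 1) + (t + m)) * t * (t + m) * (t * (t + m) * den_U t)
  + (t ^+ 2 * (t + m) - 2%:R * (m - 1) * t - (t + m) + t * (t + m)) * (t + m) * (t * (t + m) * den_U t)
  + (m - 1) * (n + 3%:R) * t * den_U t * den_W t
  - t * (t * (t + m) * den_U t * den_W t)); last first.
  by field; rewrite tn tmn Un' Wn'.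
rewrite /secular_poly /den_U /den_W.
by rewrite !(hornerE, horner_exp, hornerMn) /=.
Qed.

(** At 4 the positive entries r, a, b are dropped, and clearing denominators leaves 5 n m - 4 m - 76
    >= 0. At n + 8 the bounds n / t <= 1, 2 r + a + b < 4 and beta (n + 3) <= n + 3 add up to at
    most n + 8. *)
Lemma secular_root : 1 <= m -> 56 + 5 * m <= n * m -> exists2 t, 4 <= t & secular t = 0.
Proof.
move=> m1 mn.
have n5 : 5 <= n.
  by rewrite leNgt; apply/negP => n5; have : n * m <= 5 * m; [apply: ler_wpM2r|]; lra.
have t4 : (4 : R) <= 4 by [].
have T4 : 4 <= n + 8 by lra.
have s4 : 0 <= secular 4.
  have [/andP[r0 _] /andP[a0 _] /andP[b0 _]] := entries_bounds m1 t4.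
  have a1 : 0 < a_of 4 by apply: lt_trans a0; lra.
  have m4 : 0 < 4 + m by lra.
  have : 0 <= n / 4 + beta_of 4 * (n + 3) - 4.
    have -> : n / 4 + beta_of 4 * (n + 3) - 4 =
      (5 * (n * m) - 4 * m - 76) / (4 * (4 + m)).
      by rewrite /beta_of; field; rewrite gt_eqF.
    by apply: divr_ge0; lra.
  by rewrite /secular; lra.
have sT : secular (n + 8) <= 0.
  have [/andP[_ r0] /andP[_ a0] /andP[_ b0]] := entries_bounds m1 T4.
  have /andP[be0 be1] := beta_bounds m1 T4.
  have nT : n / (n + 8) <= 1 by rewrite ler_pdivrMr; lra.
  have bn : beta_of (n + 8) * (n + 3) <= n + 3 by nra.
  by rewrite /secular; lra.
have : - secular_poly.[4] <= 0 <= - secular_poly.[n + 8].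
  rewrite oppr_le0 oppr_ge0 !secular_polyE // mulr_ge0 ?(ltW (den_gt0 m1 _)) //=.
  by rewrite mulr_le0_ge0 // ltW // den_gt0.
rewrite -!hornerN => /(@poly_ivt R (- secular_poly) _ _ T4)[t /andP[t4' _]].
rewrite /root hornerN oppr_eq0 => rt.
exists t => //; move: rt; rewrite secular_polyE // mulf_eq0 => /orP[/eqP//|].
by rewrite gt_eqF // den_gt0.
Qed.

End Secular.

Lemma star_eigenvector_exists (R : rcfType) (M N : nat) :
  (0 < M)%N -> (56 + 5 * M <= N * M)%N ->
  exists t : R, 4 <= t /\ exists l r a b w,
    star_eigenvector N ((M%:R - 1) / (t + M%:R)) t l r a b w.
Proof.
move=> M0 MN.
have m1 : 1 <= M%:R :> R by rewrite (ler_nat R 1).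
have mn : 56 + 5 * M%:R <= N%:R * M%:R :> R by rewrite -!natrM -natrD ler_nat.
have [t t4 s0] := secular_root m1 mn; exists t; split => //.
exists (1 / t), (r_of M%:R t), (a_of M%:R t), (b_of M%:R t), (a_of M%:R t / t).
exact: eigenvector_of_secular s0.
Qed.

(** * Spectral radius and energy *)

Section HypergraphEnergy.
Variables (R : realType) (H : hypergraph).
Implicit Types (w : H -> R) (h : {set H}) (mu : R).

Definition edge_energy h w := (\sum_(u in h) w u) ^+ 2 - \sum_(u in h) w u ^+ 2.
Definition hg_energy w := \sum_(h in edges H) edge_energy h w.

Lemma edge_energyE h w : edge_energy h w =
  \sum_u \sum_v ((u != v) && (u \in h) && (v \in h))%:R * (w u * w v).
Proof.
rewrite /edge_energy expr2 big_distrlr /= -sumrB big_mkcond /=.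
apply: eq_bigr => u _; case: ifP => uh; last first.
  by rewrite big1 // => v _; rewrite andbF mul0r.
rewrite (bigD1 u) //= expr2 [X in X - _]addrC addrK.
rewrite [LHS]big_mkcond /=; apply: eq_bigr => v _.
by rewrite andbT andbC eq_sym; case: ifP; rewrite ?mul1r ?mul0r.
Qed.

Lemma adj_sym : symmetric (@adj H).
Proof.
by move=> u v; rewrite /adj eq_sym; congr (_ && _); apply: eq_existsb => e; rewrite (andbC (u \in e)).
Qed.

Lemma adj_irr u : @adj H u u = false.
Proof. by rewrite /adj eqxx. Qed.

(** By linearity an adjacent pair lies in exactly one edge, so the form is that of the 0-1 adjacency
    matrix, m - 1 times [adjacency]. *)
Lemma hg_energyE w : linear_hg H ->
  hg_energy w = \sum_u \sum_v (adj u v)%:R * (w u * w v).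
Proof.
move=> lin; rewrite /hg_energy.
under eq_bigr do rewrite edge_energyE.
rewrite exchange_big /=; apply: eq_bigr => u _.
rewrite exchange_big /=; apply: eq_bigr => v _.
rewrite -mulr_suml; congr (_ * _).
rewrite /adj; case: eqVneq => [_|nuv] /=; first by rewrite big1.
case: existsP => [[e /and3P[eE ue ve]]|no]; last first.
  rewrite big1 // => e eE; case: (boolP (_ && _)) => // /andP[ue ve].
  by case: no; exists e; rewrite eE ue ve.
rewrite (bigD1 e) //= ue ve big1 ?addr0 // => g /andP[gE nge].
case: (boolP (_ && _)) => // /andP[ug vg].
have := lin g e gE eE nge; rewrite leqNgt => /negP[].
apply: (@leq_trans #|[set u; v]|); first by rewrite cards2 nuv.
apply: subset_leq_card.
by apply/subsetP => s; rewrite !inE => /orP[]/eqP->; rewrite ?ug ?vg ?ue ?ve.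
Qed.

(* First variation of the quadratic form at a maximiser. *)
Lemma hg_energy_variation mu w0 : linear_hg H -> 0 < mu ->
  (forall w, hg_energy w <= mu * \sum_u w u ^+ 2) ->
  hg_energy w0 = mu * \sum_u w0 u ^+ 2 ->
  forall s, mu * w0 s = \sum_v (adj s v)%:R * w0 v.
Proof.
move=> lin mu0 le eq0 s.
pose L u := \sum_v (adj u v)%:R * w0 v.
have Fq eps : hg_energy (fun u => w0 u + eps * (u == s)%:R) =
    hg_energy w0 + 2 * eps * L s.
  rewrite !hg_energyE //.
  have E u : \sum_v (adj u v)%:R * ((w0 u + eps * (u == s)%:R) * (w0 v + eps * (v == s)%:R))
     = \sum_v (adj u v)%:R * (w0 u * w0 v) + eps * ((u == s)%:R * L u)
       + eps * ((adj u s)%:R * w0 u) + eps ^+ 2 * ((u == s)%:R * (adj u s)%:R).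
    have -> : (adj u s)%:R = \sum_v (adj u v)%:R * (v == s)%:R :> R.
      rewrite (bigD1 s) //= eqxx mulr1 big1 ?addr0 // => v /negPf->.
      by rewrite mulr0.
    rewrite /L mulr_suml !mulr_sumr -!big_split /=; apply: eq_bigr => v _.
    by ring.
  under eq_bigr do rewrite E.
  rewrite !big_split /= -!mulr_sumr.
  have d1 (G : H -> R) : \sum_u (u == s)%:R * G u = G s.
    rewrite (bigD1 s) //= eqxx mul1r big1 ?addr0 // => v /negPf->.
    by rewrite mul0r.
  rewrite !d1 adj_irr mulr0 addr0.
  have -> : \sum_u (adj u s)%:R * w0 u = L s.
    by apply: eq_bigr => u _; rewrite adj_sym.
  by ring.
have Sq eps : \sum_u (w0 u + eps * (u == s)%:R) ^+ 2 =
    \sum_u w0 u ^+ 2 + 2 * eps * w0 s + eps ^+ 2.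
  have -> : w0 s = \sum_u (u == s)%:R * w0 u.
    rewrite (bigD1 s) //= eqxx mul1r big1 ?addr0 // => v /negPf->.
    by rewrite mul0r.
  have -> : eps ^+ 2 = eps ^+ 2 * \sum_u (u == s)%:R.
    by rewrite (bigD1 s) //= eqxx big1 ?addr0 ?mulr1 // => v /negPf->.
  rewrite !mulr_sumr -!big_split /=; apply: eq_bigr => u _.
  by case: (u == s); rewrite /= ?mulr1n ?mulr0n; ring.
apply/eqP; rewrite -subr_eq0 -/(L s); apply/eqP; set b := _ - _.
(* The bound reads 0 <= 2 eps b + mu eps^2; at the minimiser eps = - b / mu the right-hand side is -
   b^2 / mu. *)
have := le (fun u => w0 u + (- (b / mu)) * (u == s)%:R); rewrite Fq Sq eq0.
move: (\sum_u w0 u ^+ 2) => S0.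
have bE : mu * w0 s = b + L s by rewrite /b subrK.
have q0 : b / mu * b = mu * (b / mu) ^+ 2 by field; rewrite gt_eqF.
rewrite !mulrDr -subr_ge0.
have -> : mu * S0 + mu * (2 * - (b / mu) * w0 s) + mu * (- (b / mu)) ^+ 2 -
  (mu * S0 + 2 * - (b / mu) * L s) = - (b / mu * b).
  rewrite sqrrN -q0.
  have -> : mu * (2 * - (b / mu) * w0 s) = 2 * - (b / mu) * (mu * w0 s) by ring.
  by rewrite bE; ring.
rewrite oppr_ge0 mulrAC -expr2 => H0.
apply/eqP; rewrite -sqrf_eq0 eq_le sqr_ge0 andbT.
by rewrite pmulr_lle0 // invr_gt0 in H0.
Qed.

End HypergraphEnergy.

(** * Eigenvalues and the quadratic form *)

Section Spectrum.
Local Open Scope complex_scope.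
Variables (R : realType) (m : nat) (H : hypergraph).
Hypotheses (m2 : (2 <= m)%N) (lin : linear_hg H).

Let m1_gt0 : 0 < m%:R - 1 :> R.
Proof. by rewrite subr_gt0 (ltr_nat R 1). Qed.

Local Notation cadj := (map_mx (fun x : R => x%:C) (adjacency R m H)).

Lemma sum_enum_rank (G : 'I_#|H| -> R) : \sum_i G i = \sum_(u : H) G (enum_rank u).
Proof. by rewrite (reindex (@enum_rank H)) //; apply/onW_bij/enum_rank_bij. Qed.

Lemma adjacency_rank (u v : H) : adjacency R m H (enum_rank u) (enum_rank v) =
  (m%:R - 1)^-1 * (adj u v)%:R.
Proof. by rewrite mxE !enum_rankK; case: ifP; rewrite ?mulr1 ?mulr0. Qed.

(* The moduli w of the entries of an eigenvector satisfy r w <= A w. *)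
Lemma eigenvalue_energy (z : R[i]) (r : R) : eigenvalue cadj z -> `|z| = r%:C ->
  exists w : H -> R, [/\ forall u, 0 <= w u, exists u, w u != 0 &
    (m%:R - 1) * r * \sum_u w u ^+ 2 <= hg_energy w].
Proof.
move=> /eigenvalueP[v vE v0] zr.
pose a i : R := ComplexField.Normc.normc (v 0 i).
have aE i : `|v 0 i| = (a i)%:C by [].
have a0 i : 0 <= a i by rewrite -lecR -aE normr_ge0.
have le j : r * a j <= \sum_i a i * adjacency R m H i j.
  have vj : \sum_i v 0 i * (adjacency R m H i j)%:C = z * v 0 j.
    by have /rowP/(_ j) := vE; rewrite !mxE => <-; apply: eq_bigr => i _; rewrite !mxE.
  rewrite -lecR rmorphM /= -zr -aE -normrM -vj rmorph_sum /=.
  apply: (le_trans (ler_norm_sum _ _ _)); apply: ler_sum => i _.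
  rewrite normrM aE rmorphM /= normc_def /= expr0n addr0 sqrtr_sqr ger0_norm //.
  by rewrite mxE; case: ifP => // _; rewrite invr_ge0 ltW.
exists (fun u => a (enum_rank u)); split => //.
  have /rV0Pn[i vi] := v0; exists (enum_val i); rewrite enum_valK.
  apply: contraNneq vi => ai; rewrite -normr_eq0 aE ai //.
rewrite hg_energyE // -mulrA -ler_pdivlMl //.
rewrite mulr_sumr mulr_sumr; apply: ler_sum => u _.
rewrite expr2 mulrA.
apply: (le_trans (ler_wpM2r (a0 _) (le _))).
rewrite sum_enum_rank mulr_suml mulr_sumr; apply: ler_sum => s _.
by rewrite adjacency_rank adj_sym; rewrite le_eqVlt; apply/orP; left; apply/eqP; ring.
Qed.

Lemma energy_eigenvalue (mu : R) (w : H -> R) : 0 < mu -> (exists u, w u != 0) ->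
  (forall w : H -> R, hg_energy w <= mu * \sum_u w u ^+ 2) ->
  hg_energy w = mu * \sum_u w u ^+ 2 ->
  eigenvalue cadj (mu / (m%:R - 1))%:C.
Proof.
move=> mu0 [u0 wu0] le eq0; have crit := hg_energy_variation lin mu0 le eq0.
apply/eigenvalueP; exists (\row_i (w (enum_val i))%:C); last first.
  apply/rV0Pn; exists (enum_rank u0); rewrite mxE enum_rankK.
  by apply: contraNneq wu0 => /(congr1 (@complex.Re R)) /= ->.
apply/rowP => j; rewrite !mxE.
under eq_bigr do rewrite !mxE -rmorphM.
rewrite -rmorph_sum -rmorphM /=; congr (_%:C).
rewrite mulrAC crit sum_enum_rank mulr_suml; apply: eq_bigr => u _.
rewrite enum_rankK adj_sym; case: ifP => _; first by rewrite mul1r.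
by rewrite mulr0 !mul0r.
Qed.

Lemma lambda1_le (B : R) : 0 <= B ->
  (forall z r, eigenvalue cadj z -> `|z| = r%:C -> r <= B) -> lambda1 R m H <= B.
Proof.
move=> B0 le; rewrite /lambda1 /spectral_radius; set S := classical_sets.mkset _.
(* Without eigenvalues the supremum is 0 by convention, whence the assumption 0 <= B. *)
have [->|/classical_sets.set0P ne] := eqVneq S classical_sets.set0.
  by rewrite sup0.
apply: ge_sup => // r [z ez zr]; exact: le ez zr.
Qed.

Lemma lambda1_ge (B r : R) : 0 <= r -> eigenvalue cadj r%:C ->
  (forall z s, eigenvalue cadj z -> `|z| = s%:C -> s <= B) -> r <= lambda1 R m H.
Proof.
move=> r0 er le; apply: ub_le_sup; first by exists B => s [z ez zs]; apply: le ez zs.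
by exists r%:C => //; rewrite ger0_norm // lecR.
Qed.

(** A strict bound passes to the supremum because the eigenvalues are finite in number: they are
    roots of the characteristic polynomial, and b is the largest of their moduli. *)
Lemma lambda1_lt (B : R) : 0 < B ->
  (forall z r, eigenvalue cadj z -> `|z| = r%:C -> r < B) -> lambda1 R m H < B.
Proof.
move=> B0 lt.
have [rs rsE] := closed_field_poly_normal (char_poly cadj).
pose nc (z : R[i]) : R := ComplexField.Normc.normc z.
pose b : R := \big[Num.max/0]_(z <- rs | eigenvalue cadj z) nc z.
apply: (@le_lt_trans _ _ b); last first.
  by rewrite /b; apply: bigmax_lt => // z ez; apply: lt ez _.
apply: lambda1_le; first exact: bigmax_ge_id.
move=> z r ez zr; have -> : r = nc z by move: zr => /(congr1 (@complex.Re R)) /= <-.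
apply: le_bigmax_seq => //.
move: ez; rewrite eigenvalue_root_char rsE rootZ ?root_prod_XsubC //.
by rewrite (monicP (char_poly_monic _)) oner_eq0.
Qed.

End Spectrum.

Lemma hg_energy_iso (R : realType) (H K : hypergraph) (f : H -> K) (g : K -> H)
    (w : H -> R) : cancel f g -> cancel g f ->
  [set f @: e | e : {set H} in edges H] = edges K ->
  hg_energy w = hg_energy (w \o g).
Proof.
move=> fg gf Ef; have f_inj := can_inj fg.
rewrite /hg_energy -Ef big_imset; last by move=> ? ? _ _; apply: imset_inj.
apply: eq_bigr => e _; rewrite /edge_energy !big_imset //=.
- by congr (_ ^+ 2 - _); apply: eq_bigr => u _; rewrite fg.
- by move=> ? ? _ _; apply: f_inj.
- by move=> ? ? _ _; apply: f_inj.
Qed.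

Lemma sum_cancel (R : nmodType) (H K : finType) (f : H -> K) (g : K -> H)
    (F : H -> R) : cancel f g -> cancel g f -> \sum_u F u = \sum_u F (g u).
Proof. by move=> fg gf; apply: reindex; exists f => u _; rewrite ?fg ?gf. Qed.

(** On an edge u v the summand equals [energy beta x u v]; written with 1 - beta, it has the shape
    that elimination of the added vertices produces. *)
Definition graph_energy (R : pzRingType) (T : finType) (beta : R) (x : T -> R)
    (E : {set {set T}}) :=
  \sum_(e in E) ((\sum_(u in e) x u) ^+ 2 - (1 - beta) * \sum_(u in e) x u ^+ 2).

Lemma sumr_square_le (R : realDomainType) (I : finType) (y : I -> R) :
  (\sum_i y i) ^+ 2 <= #|I|%:R * \sum_i y i ^+ 2.
Proof.
rewrite -(ler_pM2l (ltr0n R 2)) -subr_ge0.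
have -> : 2 * (#|I|%:R * \sum_i y i ^+ 2) - 2 * (\sum_i y i) ^+ 2 =
    \sum_i \sum_j (y i - y j) ^+ 2.
  have E i : \sum_j (y i - y j) ^+ 2 =
      #|I|%:R * y i ^+ 2 - 2 * (y i * \sum_j y j) + \sum_j y j ^+ 2.
    rewrite !mulr_sumr mulr_natl -sumr_const -sumrB -big_split /=.
    by apply: eq_bigr => j _; ring.
  rewrite [RHS](eq_bigr _ (fun i _ => E i)).
  rewrite big_split sumrB /= -!mulr_sumr -mulr_suml sumr_const.
  by rewrite -[_ *+ _]mulr_natl; ring.
by apply: sumr_ge0 => i _; apply: sumr_ge0 => j _; apply: sqr_ge0.
Qed.

(** * Eliminating the added vertices *)

Section PowerEnergy.
Variables (R : realType) (m : nat) (G : hypergraph).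
Local Notation sigE := {e : {set G} | e \in edges G}.
Local Notation K := (power m G).
Local Notation q := ((m - 2)%:R : R).

Lemma sum_power (F : K -> R) :
  \sum_u F u = \sum_x F (inl x) + \sum_(e : sigE) \sum_(j < m - 2) F (inr (e, j)).
Proof. by rewrite big_sumType /= pair_bigA /=; congr (_ + _); apply: eq_bigr => -[]. Qed.

Lemma sum_power_edge (F : K -> R) (e : sigE) :
  \sum_(u in @power_edge m G e) F u =
  \sum_(x in val e) F (inl x) + \sum_(j < m - 2) F (inr (e, j)).
Proof.
rewrite big_mkcond sum_power /=; congr (_ + _).
  by rewrite [RHS]big_mkcond; apply: eq_bigr => x _; rewrite inl_power_edge.
rewrite (bigD1 e) //= [X in _ + X]big1 ?addr0 => [|h nhe].
  by apply: eq_bigr => j _; rewrite inr_power_edge eqxx.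
by rewrite big1 // => j _; rewrite inr_power_edge (negPf nhe).
Qed.

Lemma sum_sig_edges (F : {set G} -> R) :
  \sum_(e in edges G) F e = \sum_(e : sigE) F (val e).
Proof. by rewrite big_sub. Qed.

Definition core_sum (w : K -> R) (e : sigE) := \sum_(x in val e) w (inl x).

(* For fixed values on the graph, the energy is largest when the added vertices
   of e all have the value core_sum w e / (t + 1). *)
Definition power_defect (t : R) (w : K -> R) :=
  \sum_(e : sigE) ((t + 1) *
      \sum_(j < m - 2) (w (inr (e, j)) - core_sum w e / (t + 1)) ^+ 2 +
    (q * \sum_(j < m - 2) w (inr (e, j)) ^+ 2 -
     (\sum_(j < m - 2) w (inr (e, j))) ^+ 2)).

(** Completing the square on an edge with core sum s leaves s^2 (t + q + 1) / (t + 1). Dividing by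
    this factor turns the coefficient 1 into 1 - beta and t + q into t + beta. *)
Lemma power_energyE (t : R) (w : K -> R) : 0 < t ->
  hg_energy w - (t + q) * \sum_u w u ^+ 2 =
  (t + q + 1) / (t + 1) *
    (graph_energy (q / (t + q + 1)) (fun x => w (inl x)) (edges G) -
     (t + q / (t + q + 1)) * \sum_x w (inl x) ^+ 2)
  - power_defect t w.
Proof.
move=> t0; have q0 : 0 <= q by rewrite ler0n.
have t1 : t + 1 != 0 by rewrite gt_eqF // addr_gt0.
have tq1 : t + q + 1 != 0 by rewrite gt_eqF //; lra.
rewrite /hg_energy big_imset /=; last by move=> ? ? _ _; apply: power_edge_inj.
rewrite (eq_bigr (fun e => (core_sum w e + \sum_(j < m - 2) w (inr (e, j))) ^+ 2
  - (\sum_(x in val e) w (inl x) ^+ 2 + \sum_(j < m - 2) w (inr (e, j)) ^+ 2))); last first.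
  by move=> e _; rewrite /edge_energy !sum_power_edge.
rewrite sum_power /graph_energy sum_sig_edges /power_defect.
rewrite [X in _ = X - _]mulrBr [X in _ = X - _ - _]mulr_sumr.
rewrite [LHS](_ : _ = \sum_(e : sigE)
   ((core_sum w e + \sum_(j < m - 2) w (inr (e, j))) ^+ 2
  - (\sum_(x in val e) w (inl x) ^+ 2 + \sum_(j < m - 2) w (inr (e, j)) ^+ 2)
  - (t + q) * \sum_(j < m - 2) w (inr (e, j)) ^+ 2) - (t + q) * \sum_x w (inl x) ^+ 2);
  last by rewrite [X in _ = X - _]sumrB -mulr_sumr; ring.
rewrite addrAC -sumrB; congr (_ - _); last first.
  by field; rewrite t1 tq1.
apply: eq_bigr => e _; rewrite -/(core_sum w e).
have -> : \sum_(j < m - 2) (w (inr (e, j)) - core_sum w e / (t + 1)) ^+ 2 =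
   \sum_(j < m - 2) w (inr (e, j)) ^+ 2
   - 2 * (core_sum w e / (t + 1)) * \sum_(j < m - 2) w (inr (e, j))
   + q * (core_sum w e / (t + 1)) ^+ 2.
  have -> : q * (core_sum w e / (t + 1)) ^+ 2 =
      \sum_(j < m - 2) (core_sum w e / (t + 1)) ^+ 2.
    by rewrite sumr_const card_ord mulr_natl.
  rewrite mulr_sumr -sumrB -big_split /=.
  by apply: eq_bigr => j _; ring.
move: (core_sum w e) (\sum_(j < m - 2) w (inr (e, j)))
  (\sum_(j < m - 2) w (inr (e, j)) ^+ 2) (\sum_(x in val e) w (inl x) ^+ 2).
by move: (q) tq1 => p p1 X Y Y2 S2; field; rewrite t1 p1.
Qed.

Lemma power_defect_ge0 t w : 0 < t -> 0 <= power_defect t w.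
Proof.
move=> t0; apply: sumr_ge0 => e _; apply: addr_ge0.
  apply: mulr_ge0; first by rewrite addr_ge0 // ltW.
  by apply: sumr_ge0 => j _; apply: sqr_ge0.
by have := sumr_square_le (fun j => w (inr (e, j))); rewrite card_ord subr_ge0.
Qed.

Lemma power_defect_eq0 t w : 0 < t -> power_defect t w = 0 ->
  (forall x, w (inl x) = 0) -> forall u, w u = 0.
Proof.
move=> t0 D0 w0 [x|[e j]]; first exact: w0.
have ge0 (h : sigE) : 0 <= (t + 1) *
      \sum_(j < m - 2) (w (inr (h, j)) - core_sum w h / (t + 1)) ^+ 2.
  apply: mulr_ge0; first by rewrite addr_ge0 // ltW.
  by apply: sumr_ge0 => i _; apply: sqr_ge0.
have ge0' (h : sigE) : 0 <= q * \sum_(j < m - 2) w (inr (h, j)) ^+ 2 -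
     (\sum_(j < m - 2) w (inr (h, j))) ^+ 2.
  by have := sumr_square_le (fun j => w (inr (h, j))); rewrite card_ord subr_ge0.
have /(_ e isT) := psumr_eq0P (fun h _ => addr_ge0 (ge0 h) (ge0' h)) D0.
move/eqP; rewrite paddr_eq0 // mulf_eq0 => /andP[/orP[t1|/eqP S0] _].
  by rewrite gt_eqF ?addr_gt0 in t1.
have /(_ j isT) := psumr_eq0P (fun i _ => sqr_ge0 _) S0.
move/eqP; rewrite sqrf_eq0 subr_eq0 /core_sum big1 ?mul0r => [/eqP //|x _].
exact: w0.
Qed.

Definition power_extension (t : R) (x : G -> R) (u : K) : R :=
  match u with
  | inl v => x v
  | inr (e, _) => (\sum_(v in val e) x v) / (t + 1)
  end.

Lemma power_defect_extension t x : power_defect t (power_extension t x) = 0.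
Proof.
apply: big1 => e _ /=; rewrite [X in _ * X + _]big1 ?mulr0 ?add0r => [|j _].
  rewrite !sumr_const !card_ord; set z := _ / _.
  by rewrite -(mulr_natl z) -(mulr_natl (z ^+ 2)); ring.
by rewrite /core_sum /= subrr expr0n.
Qed.

End PowerEnergy.

Section RootedEnergy.
Variables (R : realFieldType) (T : finType) (beta : R) (x : T -> R).
Variables (E : {set {set T}}) (c : T) (p : T -> T) (a b d f : T).
Hypothesis un : uniq [:: c; a; b; d; f].
Hypothesis EE :
  E = [set [set v; p v] | v in [set~ c]] :|: [set [set a; b]; [set d; f]].
Hypothesis p_inj : {in [set~ c] &, injective (fun v => [set v; p v])}.
Hypothesis p_neq : forall v, v != c ->
  [&& v != p v, [set v; p v] != [set a; b] & [set v; p v] != [set d; f]].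

Lemma rooted_disjoint : [disjoint [set [set v; p v] | v in [set~ c]] &
  [set [set a; b]; [set d; f]]].
Proof.
rewrite disjoint_subset; apply/subsetP => _ /imsetP[v + ->].
by rewrite !inE => /p_neq /and3P[_ /negPf -> /negPf ->].
Qed.

Lemma rooted_pair_neq : [set a; b] != [set d; f].
Proof.
apply/eqP => /setP/(_ a); rewrite !inE eqxx => /esym.
by move: un => /= /and5P[_ + _ _ _]; rewrite !inE !negb_or => /and3P[_ /negPf -> /negPf ->].
Qed.

Lemma graph_energy_rooted : graph_energy beta x E = rooted_energy beta x c p a b d f.
Proof.
have pairE u v : u != v -> (\sum_(s in [set u; v]) x s) ^+ 2 -
    (1 - beta) * \sum_(s in [set u; v]) x s ^+ 2 = energy beta x u v.
  move=> uv; rewrite !big_setU1 ?inE //= !big_set1 /energy.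
  by ring.
have [ab df] : a != b /\ d != f by split; move: un; distinct.
rewrite /graph_energy EE.
rewrite (eq_bigl [predU [set [set v; p v] | v in [set~ c]] &
  [set [set a; b]; [set d; f]]]); last by move=> e; rewrite in_setU.
rewrite bigU ?rooted_disjoint //=.
rewrite big_imset //= [X in _ + X]big_setU1 ?inE ?rooted_pair_neq //= big_set1.
rewrite !pairE // addrA /rooted_energy; congr (_ + _ + _).
rewrite (eq_bigl (fun v => v != c)) => [|v]; last by rewrite !inE.
by apply: eq_bigr => v /p_neq /andP[vp _]; rewrite pairE.
Qed.

Lemma card_rooted : #|E| = #|T|.+1.
Proof.
rewrite EE cardsU (disjoint_setI0 rooted_disjoint) cards0 subn0.
rewrite (card_in_imset p_inj) cardsC1 cards2 rooted_pair_neq.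
have : (0 < #|T|)%N by apply/card_gt0P; exists c.
by lia.
Qed.

End RootedEnergy.

Section StarGraph.
Variables (R : realFieldType) (T : finType) (beta : R).
Variables (E : {set {set T}}) (c a b d f w : T).
Hypothesis shape : star_shape E c a b d f w.

Lemma star_graph_energy (x : T -> R) :
  graph_energy beta x E = rooted_energy beta x c (star c w a) a b d f.
Proof.
have [un EE] := shape.
have un5 : uniq [:: c; a; b; d; f] by move: un; distinct.
have /and5P[aw wc wa wb /and3P[wd ac ca]] :
    [&& a != w, w != c, w != a, w != b, w != d, a != c & c != a].
  by move: un; distinct.
have [/negPf ncab /negPf ncdf] : c \notin [set a; b] /\ c \notin [set d; f].
  by split; move: un; distinct.
have [/negPf nwab /negPf nwdf] : w \notin [set a; b] /\ w \notin [set d; f].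
  by split; move: un; distinct.
apply: (graph_energy_rooted beta x un5 EE).
- move=> v v'; rewrite !inE => vc vc' /set2_eq[[-> //]|[vE pvE]].
  have pv' : star c w a v' = a.
    by move: vE vc; rewrite /star; case: ifP => // _ ->; rewrite eqxx.
  have v'w : v' = w.
    by apply/eqP; apply: contraTT wa => nv'; move: pv' ca; rewrite /star (negPf nv') => ->; rewrite eqxx.
  by move: pvE; rewrite vE pv' /star (negPf aw) v'w => cw; rewrite cw eqxx in wc.
- move=> v vc; rewrite /star; have [->|vw] := eqVneq v w.
    rewrite wa /=; apply/andP; split; apply/eqP => /setP/(_ w).
      by rewrite nwab !inE eqxx.
    by rewrite nwdf !inE eqxx.
  rewrite vc /=; apply/andP; split; apply/eqP => /setP/(_ c).
    by rewrite ncab !inE eqxx orbT.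
  by rewrite ncdf !inE eqxx orbT.
Qed.

End StarGraph.

Lemma two_cycles_card (T : finType) (E : {set {set T}}) C1 C2 :
  (forall e, e \in E -> #|e| = 2) -> (forall x y, connect (gadj E) x y) ->
  two_cycles E C1 C2 -> #|E| = #|T|.+1.
Proof.
move=> E2 Econ tc; have [_ [c1 s1] _ _] := tc.
have [e eC] := loose_cycle_neq0 c1.
have [u [v _]] := card2P (E2 _ (subsetP s1 _ eC)).
have [p [a [b [d [f [un EE inj ne _]]]]]] := cactus_decomposition_exists E2 Econ u tc.
exact: (card_rooted un EE inj ne).
Qed.

(** * The bound for graphs with two cycles *)

Section GraphBound.
Variables (R : realFieldType) (T : finType) (E : {set {set T}}).
Variables (N : nat) (beta t l r ya yb yw : R).
Hypothesis beta0 : 0 <= beta.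
Hypothesis eig : star_eigenvector N beta t l r ya yb yw.
Hypothesis cardT : #|T| = (N + 6)%N.

Lemma star_graph_bound c a b d f w (x : T -> R) : star_shape E c a b d f w ->
  graph_energy beta x E <= (t + beta) * \sum_v x v ^+ 2.
Proof.
move=> sh; rewrite (star_graph_energy beta sh).
have [un _] := sh; exact: star_energy_le eig un cardT.
Qed.

Lemma star_graph_bound_eq c a b d f w : star_shape E c a b d f w ->
  exists x : T -> R, (exists v, x v != 0) /\
  graph_energy beta x E = (t + beta) * \sum_v x v ^+ 2.
Proof.
move=> sh; have [un _] := sh.
exists (star_vector l r ya yb yw c a b d f w); split.
  by exists c; rewrite /star_vector eqxx oner_eq0.
rewrite (star_graph_energy beta sh); apply/esym/eqP; rewrite -subr_eq0.
rewrite (star_defectE _ eig un cardT) /star_defect.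
have ne : [&& a != c, b != c, d != c, f != c, w != c & b != a].
  by move: un; distinct.
have ne' : [&& d != a, d != b, f != a, f != b, w != a, w != b, w != d & w != f].
  by move: un; distinct.
have := ne; have := ne'.
move=> /and5P[da db fa fb /and4P[wa wb wd wf]] /and5P[ac bc dc fc /andP[wc ba]].
rewrite big1 => [|v]; last first.
  rewrite !inE !negb_or => /and5P[vc va vb vd /andP[vf vw]].
  rewrite /star_vector (negPf vc) (negPf va) (negPf vb) (negPf vd) (negPf vf).
  by rewrite (negPf vw) eqxx mulr1 subrr expr0n mulr0.
rewrite /star_vector !eqxx (negPf ac) (negPf bc) (negPf dc) (negPf fc) (negPf wc).
rewrite (negPf ba) (negPf da) (negPf db) (negPf fa) (negPf fb) (negPf wa) (negPf wb).
rewrite (negPf wd) (negPf wf) orbT /=.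
have [_ _ _ _ _ _ _ /andP[l0 _] /andP[r0 _] /andP[al _] /andP[b0 _]
  /andP[w0 _]] := eig.
have a0 : 0 < ya by apply: lt_trans al.
have nz (y : R) : 0 < y -> y / y = 1 by move=> y0; rewrite divff // gt_eqF.
by rewrite !nz // !subrr expr0n /= !mulr0 !addr0.
Qed.

(** The tree is rooted at a maximum of x, as the shifts require. If all vertices hang at that root,
    the graph is the excluded spider with L empty. *)
Lemma cactus_graph_bound C1 C2 (x : T -> R) :
  (forall e, e \in E -> #|e| = 2) -> (forall u v, connect (gadj E) u v) ->
  two_cycles E C1 C2 ->
  (forall c a b d f, ~ spider_shape E c a b d f set0) ->
  (forall v, 0 <= x v) -> (exists v, x v != 0) ->
  graph_energy beta x E <= (t + beta) * \sum_v x v ^+ 2 /\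
  (graph_energy beta x E = (t + beta) * \sum_v x v ^+ 2 ->
   exists c a b d f w, star_shape E c a b d f w).
Proof.
move=> E2 Econ tc nBC x0 [v0 xv0].
pose c := [arg max_(v > v0) x v]%O.
have xc v : x v <= x c.
  by rewrite /c; case: arg_maxP => // i _ H; apply: H.
have xc0 : 0 < x c.
  by apply: lt_le_trans (xc v0); rewrite lt_def xv0 x0.
have [p [a [b [d [f D]]]]] := cactus_decomposition_exists E2 Econ c tc.
have [un EE inj ne _] := D.
rewrite (graph_energy_rooted beta x un EE inj ne).
have [/existsP[w /andP[wc pwc]]|none] := boolP [exists w, (w != c) && (p w != c)].
  have bound a' b' d' f' w' : uniq [:: c; a'; b'; d'; f'; w'] ->
      rooted_energy beta x c (star c w' a') a' b' d' f' <= (t + beta) * \sum_v x v ^+ 2 /\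
      (rooted_energy beta x c (star c w' a') a' b' d' f' = (t + beta) * \sum_v x v ^+ 2 ->
       [/\ forall v, 0 < x v, forall v, v != c -> x v < x c &
           forall v, v \notin [:: c; a'; b'; d'; f'] -> x v < x a']).
    move=> un'; split; first exact: star_energy_le eig un' cardT.
    exact: star_energy_eq_order eig un' cardT xc0.
  have [|le eq] := rooted_energy_max beta0 x0 xc bound D _ wc pwc.
    by rewrite cardT; lia.
  by split => // /eq [a' [b' [d' [f' [w' sh]]]]]; exists c, a', b', d', f', w'.
case: (nBC c a b d f); split => //; first by move=> v; rewrite inE.
rewrite EE; congr (_ :|: _); apply: eq_in_imset => v; rewrite !inE => vc.
move: none; rewrite negb_exists => /forallP/(_ v).
by rewrite vc /= negbK => /eqP ->.
Qed.

End GraphBound.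

(** * From the hypergraph to the graph *)

Section Eliminate.
Variables (R : realType) (m : nat) (H G : hypergraph) (t : R).
Hypotheses (m1 : (1 < m)%N) (t0 : 0 < t) (HG : hg_iso H (power m G)).
Local Notation q := ((m - 2)%:R : R).
Local Notation beta := (q / (t + q + 1)).

Lemma hg_energy_le_graph (w : H -> R) : (forall u, 0 <= w u) -> (exists u, w u != 0) ->
  (t + q) * \sum_u w u ^+ 2 <= hg_energy w ->
  exists x : G -> R, [/\ forall v, 0 <= x v, exists v, x v != 0,
    (t + beta) * \sum_v x v ^+ 2 <= graph_energy beta x (edges G) &
    (t + q) * \sum_u w u ^+ 2 < hg_energy w ->
    (t + beta) * \sum_v x v ^+ 2 < graph_energy beta x (edges G)].
Proof.
move=> w0 [u0 wu0] le; have [f [g fg gf] Ef] := HG; have tpos := t0.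
pose wp := w \o g.
have Ew : hg_energy w = hg_energy wp := hg_energy_iso w fg gf Ef.
have Sw : \sum_u w u ^+ 2 = \sum_u wp u ^+ 2.
  exact: (sum_cancel (fun u => w u ^+ 2) fg gf).
have q0 : 0 <= q by rewrite ler0n.
have c0 : 0 < (t + q + 1) / (t + 1) by apply: divr_gt0; lra.
have := power_energyE wp t0; have D0 := power_defect_ge0 wp t0.
set D := power_defect t wp in D0 *; rewrite -Ew -Sw => E.
have gap : (t + q + 1) / (t + 1) * (graph_energy beta (fun x => wp (inl x)) (edges G) -
     (t + beta) * \sum_x wp (inl x) ^+ 2) = hg_energy w - (t + q) * \sum_u w u ^+ 2 + D.
  by rewrite E subrK.
exists (fun x => wp (inl x)); split.
- by move=> v; apply: w0.
(* If w vanished on G, the gap would force the defect to be 0 and w to vanish on the added vertices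
   too. *)
- apply/existsP; apply: contraNT wu0; rewrite negb_exists => /forallP x0.
  have xE v : wp (inl v) = 0 by apply/eqP; have := x0 v; rewrite negbK.
  rewrite -(fg u0); apply/eqP; apply: (power_defect_eq0 t0 _ xE (f u0)).
  apply/eqP; rewrite eq_le D0 andbT -/D.
  move: gap; rewrite [graph_energy _ _ _]big1 => [|e _]; last first.
    rewrite big1 => [|v _]; last by rewrite xE.
    by rewrite big1 => [|v _]; rewrite ?xE ?expr0n ?mulr0 ?subrr.
  rewrite big1 => [|v _]; last by rewrite xE expr0n.
  by rewrite mulr0 subrr mulr0 => H0; lra.
- rewrite -subr_ge0 -(pmulr_rge0 _ c0) gap; lra.
- by move=> lt; rewrite -subr_gt0 -(pmulr_rgt0 _ c0) gap; lra.
Qed.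

End Eliminate.

Section Bound.
Variables (R : realType) (m N : nat) (t l r ya yb yw : R).
Local Notation q := ((m - 2)%:R : R).
Local Notation beta := (q / (t + q + 1)).
Hypotheses (m1 : (1 < m)%N) (t0 : 0 < t).
Hypothesis eig : star_eigenvector N beta t l r ya yb yw.

Let m1_gt0 : 0 < m%:R - 1 :> R.
Proof. by rewrite subr_gt0 (ltr_nat R 1). Qed.

Let q0 : 0 <= q. Proof. by rewrite ler0n. Qed.

Let tq0 : 0 < t + q. Proof. by apply: ltr_wpDr. Qed.

Let beta0 : 0 <= beta.
Proof. by rewrite divr_ge0 // ltW // ltr_wpDr. Qed.

(** The upper bound comes from the sum of squares. For the lower one, the eigenvector of the graph,
    extended with zero defect, attains the bound of the form and is therefore an eigenvector of the
    hypergraph. *)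
Lemma lambda1_B2C : lambda1 R m (B2C m N 1) = (t + q) / (m%:R - 1).
Proof.
set H := B2C m N 1; set G := b2c_graph N 1.
have HG : hg_iso H (power m G) := B2C_iso_power N 1 m1.
have lin : linear_hg H := hg_iso_linear HG (power_linear (G := G) (@b2c_graph_uniform N 1)).
have cG : #|G| = (N + 6)%N by rewrite card_b2c_graph; lia.
have sh : exists c a b d f w, star_shape (edges G) c a b d f w.
  have := b2c_graph_shape N 1.
  have -> : [set inr k | k : 'I_1] = [set inr ord0 : 'I_3 + 'I_2 + 'I_N + 'I_1].
    apply/setP => v; rewrite inE; apply/imsetP/eqP => [[k _ ->]|->]; last by exists ord0.
    by rewrite (ord1 k).
  by move=> sh; do 6 eexists; apply: spider_star_shape sh.
have [c [a [b [d [f [w {}sh]]]]]] := sh.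
have t1 : 0 < t + 1 by apply: addr_gt0.
have c0 : 0 < (t + q + 1) / (t + 1) by rewrite divr_gt0 // addr_gt0.
have [h [h' hh' h'h] Eh] := HG.
have energyH (w' : H -> R) : hg_energy w' = hg_energy (w' \o h').
  exact: hg_energy_iso hh' h'h Eh.
have sumH (w' : H -> R) : \sum_u w' u ^+ 2 = \sum_u (w' \o h') u ^+ 2.
  exact: (sum_cancel (fun u => w' u ^+ 2) hh' h'h).
have le (w' : H -> R) : hg_energy w' <= (t + q) * \sum_u w' u ^+ 2.
  rewrite energyH sumH -subr_le0 (power_energyE _ t0).
  rewrite subr_le0; apply: le_trans (power_defect_ge0 _ t0).
  by rewrite pmulr_rle0 // subr_le0; apply: (star_graph_bound eig cG _ sh).
have [x [[v xv] xE]] := star_graph_bound_eq eig cG sh.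
pose w0 : H -> R := power_extension t x \o h.
have w0E : w0 \o h' =1 power_extension t x by move=> u; rewrite /w0 /comp h'h.
have eq : hg_energy w0 = (t + q) * \sum_u w0 u ^+ 2.
  apply/eqP; rewrite energyH sumH -subr_eq0 (power_energyE _ t0).
  rewrite /w0 (_ : _ \o h \o h' = power_extension t x); last exact/funext.
  by rewrite power_defect_extension subr0 xE subrr mulr0.
have ev := energy_eigenvalue m lin tq0 (ex_intro _ (h' (inl v)) _) le eq.
have {}ev := ev (etrans (congr1 (fun y => y != 0) (w0E (inl v))) xv).
have ub z s : eigenvalue (map_mx (fun x : R => (x%:C)%C) (adjacency R m H)) z ->
    `|z| = (s%:C)%C -> s <= (t + q) / (m%:R - 1).
  move=> ez zs; have [w' [_ [u wu] le']] := eigenvalue_energy m1 lin ez zs.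
  rewrite ler_pdivlMr // mulrC.
  have S0 : 0 < \sum_u w' u ^+ 2.
    rewrite lt_def sumr_ge0 ?andbT => [|i _]; last exact: sqr_ge0.
    apply: contraNneq wu => /(psumr_eq0P (fun i _ => sqr_ge0 (w' i))) /(_ u isT).
    by move/eqP; rewrite sqrf_eq0.
  by rewrite -(ler_pM2r S0); apply: le_trans (le w').
have B0 : 0 <= (t + q) / (m%:R - 1) by rewrite divr_ge0 // ltW.
by apply: le_anti; rewrite (lambda1_le B0 ub) (lambda1_ge B0 ev ub).
Qed.

(** Stated for single eigenvalues together with the case of equality, since the supremum is taken
    only afterwards. An s not below the bound reverses the inequality for its vector of moduli, and
    elimination carries this to G. *)
Lemma cactus_eigenvalue H G C1 C2 : linear_hg H -> uniform 2 G ->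
  hg_iso H (power m G) -> (forall u v, connect (gadj (edges G)) u v) ->
  two_cycles (edges G) C1 C2 -> #|G| = (N + 6)%N ->
  (forall c a b d f, ~ spider_shape (edges G) c a b d f set0) ->
  forall (z : R[i]) (s : R),
    eigenvalue (map_mx (fun x : R => (x%:C)%C) (adjacency R m H)) z ->
    `|z| = (s%:C)%C ->
    s <= (t + q) / (m%:R - 1) /\
    (s = (t + q) / (m%:R - 1) ->
     exists c a b d f w, star_shape (edges G) c a b d f w).
Proof.
move=> lin G2 HG con tc cG nBC z s ez zs.
have [w [w0 [u wu] le]] := eigenvalue_energy m1 lin ez zs.
have S0 : 0 < \sum_u w u ^+ 2.
  rewrite lt_def sumr_ge0 ?andbT => [|i _]; last exact: sqr_ge0.
  apply: contraNneq wu => /(psumr_eq0P (fun i _ => sqr_ge0 (w i))) /(_ u isT).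
  by move/eqP; rewrite sqrf_eq0.
have [lts|les] := ltrP s ((t + q) / (m%:R - 1)).
  by split; [exact: ltW | move=> E; rewrite E ltxx in lts].
have les' : t + q <= (m%:R - 1) * s by rewrite mulrC -ler_pdivrMr.
have leH : (t + q) * \sum_u w u ^+ 2 <= hg_energy w.
  by apply: le_trans le; rewrite ler_pM2r.
have [x [x0 xn0 lex ltx]] :=
  hg_energy_le_graph t0 HG w0 (ex_intro _ u wu) leH.
have [ge eq] := cactus_graph_bound beta0 eig cG G2 con tc nBC x0 xn0.
have E : graph_energy beta x (edges G) = (t + beta) * \sum_v x v ^+ 2.
  by apply: le_anti; rewrite ge lex.
split; last by move=> _; apply: eq.
rewrite leNgt; apply/negP => lts; suff : (t + beta) * \sum_v x v ^+ 2 <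
    graph_energy beta x (edges G) by rewrite E ltxx.
apply: ltx; apply: lt_le_trans le; rewrite ltr_pM2r //.
by rewrite mulrC -ltr_pdivrMr.
Qed.

End Bound.

Local Close Scope ring_scope.

Theorem theorem4p0p2 (R : realType) (m k : nat) (H : hypergraph)
  (hm : (2 <= m)%N)
  (hP : in_P m H)
  (hconn : connected_hg H)
  (hbi : bicyclic H)
  (hlin : linear_hg H)
  (hunif : uniform m H)
  (hk : #|edges H| = k)
  (hk8 : (8 <= k)%N)
  (hne : ~ hg_iso H (B2C m (k - 6) 0))
  (hkm : ((k%:Z - 12) * (m%:Z - 1) >= 56)%R) :
  (lambda1 R m H <= lambda1 R m (B2C m (k - 7) 1))%R /\
  (lambda1 R m H = lambda1 R m (B2C m (k - 7) 1) ->
   hg_iso H (B2C m (k - 7) 1)).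
Proof.
have [G G2 HG] := hP.
have [C1 [C2 tc]] := bicyclic_two_cycles G2 hm hunif HG hbi.
have con : forall u v, connect (gadj (edges G)) u v.
  exact: (connected_power G2 (hg_iso_connected HG hconn)).
have cE : #|edges G| = k by rewrite -hk (hg_iso_card_edges HG) card_power_edges.
have cG : #|G| = (k - 7 + 6)%N.
  by have := two_cycles_card G2 con tc; rewrite cE; lia.
(* There are k - 7 pendant vertices at the centre, and (k - 7)(m - 1) = (k - 12)(m - 1) + 5 (m -
   1). *)
have MN : (56 + 5 * (m - 1) <= (k - 7) * (m - 1))%N.
  have [M mE] : exists M, m = M.+1 by exists m.-1; lia.
  have [K kE] : exists K, k = (K + 7)%N by exists (k - 7)%N; lia.
  by move: hkm; rewrite mE kE !addnK subn1 /=; nia.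
have M0 : (0 < m - 1)%N by lia.
have [t [t4 [l [r [ya [yb [yw eig]]]]]]] := star_eigenvector_exists R M0 MN.
have t0 : (0 < t)%R by apply: lt_le_trans t4; rewrite ltr0n.
have mE : ((m - 1)%:R = (m - 2)%:R + 1 :> R)%R.
  by rewrite natr1; congr (_%:R)%R; lia.
(* With m - 1 = q + 1 the parameter of the eigenvector becomes q / (t + q + 1), the beta of the
   form. *)
rewrite mE addrK addrA in eig.
have nBC c a b d f : ~ spider_shape (edges G) c a b d f set0.
  move=> sh; apply: hne; apply: (spider_shape_B2C_iso hm HG sh); rewrite ?cards0 //.
  by rewrite cG; lia.
have bound := cactus_eigenvalue hm t0 eig hlin G2 HG con tc cG nBC.
rewrite (lambda1_B2C hm t0 eig).
have B0 : (0 < (t + (m - 2)%:R) / (m%:R - 1))%R.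
  apply: divr_gt0; last by rewrite subr_gt0 (ltr_nat R 1).
  by apply: ltr_wpDr => //; rewrite ler0n.
split; first by apply: lambda1_le (ltW B0) _ => z s ez zs; case: (bound z s ez zs).
move=> lE; have [sh|nsh] := pselect (exists c a b d f w, star_shape (edges G) c a b d f w).
  have [c [a [b [d [f [w /star_shape_spider {}sh]]]]]] := sh.
  apply: (spider_shape_B2C_iso hm HG sh); rewrite ?cards1 //.
  by rewrite cG; lia.
(* Without a star shape no eigenvalue attains the bound. *)
have : (lambda1 R m H < (t + (m - 2)%:R) / (m%:R - 1))%R.
  apply: lambda1_lt => // z s ez zs; have [le eq] := bound z s ez zs.
  by rewrite lt_neqAle le andbT; apply/eqP => /eq.
by rewrite lE ltxx.
Qed.
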